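(* Let $\{X_n;\,n\ge1\}$ be a sequence of independent copies of a $\mathbf{B}$-valued random variable $X$, with $S_n=\sum_{k=1}^n X_k$. Then \[ \sum_{n=1}^{\infty}\frac1n\left(\frac{\mathbb{E}\|S_n\|}{n}\right)<\infty \] if and only if both \[ \sum_{n=1}^{\infty}\frac1n\left(\frac{\|S_n\|}{n}\right)<\infty\ \text{ almost surely} \] and \[ \mathbb{E}X=0\quad\text{and}\quad \mathbb{E}\|X\|\ln(1+\|X\|)<\infty . \]
   Context: $(\mathbf{B},\|\cdot\|)$ is a real separable Banach space with its Borel $\sigma$-algebra. The expected value $\mathbb{E}X$ of a $\mathbf B$-valued random variable $X$ is the Pettis integral: $\mathbb{E}X\in\mathbf B$ is the element with $\varphi(\mathbb{E}X)=\mathbb{E}\varphi(X)$ for every continuous linear functional $\varphi$ on $\mathbf B$. *)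

(* Defs.v *)
From HB Require Import structures.
From mathcomp Require Import all_boot all_order all_algebra.
From mathcomp Require Import all_classical all_reals all_analysis.
Set Implicit Arguments. Unset Strict Implicit. Unset Printing Implicit Defensive.
Import Order.TTheory GRing.Theory Num.Theory.
Import numFieldNormedType.Exports.
Local Open Scope classical_set_scope.
Local Open Scope ring_scope.

Definition separable_space (T : topologicalType) : Prop :=
  exists D : set T, countable D /\ closure D = setT.

Definition borel_set (T : topologicalType) : set (set T) := <<s open >>.

Definition borel_rv d (Omega : measurableType d) (T : topologicalType)
    (X : Omega -> T) : Prop :=
  forall A, borel_set A -> measurable (X @^-1` A).

Definition iid_copies d (Omega : measurableType d) (R : realType)
    (P : probability Omega R) (T : topologicalType)
    (X : Omega -> T) (Xn : nat -> Omega -> T) : Prop :=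
  [/\ borel_rv X,
      (forall n, borel_rv (Xn n)),
      (forall n A, borel_set A -> P (Xn n @^-1` A) = P (X @^-1` A)) &
      (forall (I : seq nat) (A : nat -> set T), uniq I ->
         (forall i, i \in I -> borel_set (A i)) ->
         P (\bigcap_(i in [set i | i \in I]) (Xn i @^-1` A i))
         = \big[*%E/1%E]_(i <- I) P (Xn i @^-1` A i))].

Definition pettis_expectation d (Omega : measurableType d) (R : realType)
    (P : probability Omega R) (B : normedModType R) (X : Omega -> B) (m : B) : Prop :=
  forall phi : B -> R,
    (forall (a : R) (x y : B), phi (a *: x + y) = a * phi x + phi y) ->
    continuous phi ->
    P.-integrable setT (fun w => (phi (X w))%:E) /\
    (\int[P]_w (phi (X w))%:E = (phi m)%:E)%E.

(* Main.v *)
Require Import Defs.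
From HB Require Import structures.
From mathcomp Require Import all_boot all_order all_algebra.
From mathcomp Require Import all_classical all_reals all_analysis measurable_realfun.
From mathcomp Require Import ring lra.
Import Order.TTheory GRing.Theory Num.Theory.
Import numFieldNormedType.Exports.
Set Implicit Arguments. Unset Strict Implicit. Unset Printing Implicit Defensive.
Local Open Scope classical_set_scope.
Local Open Scope ring_scope.

(** Write Y_k = |X_k| and V_N = sum_(n <= N) |S_n| / n^2.

Suppose first that the series of means converges.  With K = 2 E Y + 1 and A_k = {Y_k >= K n},
exactly one A_k occurs, or none, or at least two, so that pointwise
  sum_k Y_k 1_(A_k) <= |S_n| + sum_k |S_n - X_k| 1_(A_k)
                       + sum_(j != k) Y_k 1_(A_k) 1_(A_j).
Since n P(A_1) <= 1/2, independence yields n E[Y 1_(Y >= K n)] <= 3 E|S_n| + E Y,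
and summing over n against 1/n^2 gives E[Y ln(1 + Y)] < oo.  If phi is a
continuous functional, n |E phi(X)| <= |phi| E|S_n|, so E phi(X) <> 0 would make
the series dominate the harmonic one.

Conversely, stop at the first k with V_k > c or Y_1 + ... + Y_k > c k.  Then
  V_N <= 3 c + 2 Y_k / k + sum_(k < n <= N) |S_n - S_k| / n^2,
and the last sum is independent of the stopping event, with mean at most E V_N by
stationarity.  Hence E V_N <= C + P(stopped before N) E V_N.  Almost sure
finiteness of V and Hopf's maximal inequality make that probability at most 1/2
for c large, while E max_k Y_k / k is controlled by E[Y ln(1 + Y)]. *)

(** * Borel random elements of a separable space *)

Section borel_random_elements.
Context (R : realType) (B : completeNormedModType R).

Lemma separable_dense_seq : separable_space B ->
  exists u : nat -> B, forall (x : B) (e : R), 0 < e -> exists n, `|x - u n| < e.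
Proof.
move=> [D [cD clD]].
have [g surjg] := (@pcard_surjP _ _ D [set: nat]) cD.
exists g => x e e0.
have : closure D x by rewrite clD.
move=> /(_ (ball x e)) [|y [Dy xy]]; first exact: nbhsx_ballx.
have [n _ gn] := surjg _ Dy.
by exists n; rewrite gn; move: xy; rewrite -ball_normE.
Qed.

Lemma borel_rv_cst d (Omega : measurableType d) (b : B) :
  borel_rv (fun _ : Omega => b).
Proof.
move=> A _; rewrite /preimage; have [Ab|nAb] := pselect (A b).
  by rewrite (_ : [set _ | _] = setT)//; apply/seteqP; split.
by rewrite (_ : [set _ | _] = set0)//; apply/seteqP; split.
Qed.

Lemma borel_rv_open d (Omega : measurableType d) (X : Omega -> B) :
  (forall A, open A -> measurable (X @^-1` A)) -> borel_rv X.
Proof.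
move=> mX A bA.
have : (@open B).-sigma.-measurable A by exact: bA.
have mX' : measurable_fun [set: Omega] (X : Omega -> g_sigma_algebraType (@open B)).
  apply: (@measurability _ _ Omega (g_sigma_algebraType (@open B)) _ _ (@open B)).
    by [].
  move=> _ [C oC <-].
  by rewrite setTI; exact: mX.
by move=> mA; rewrite -[X in measurable X]setTI; exact: mX'.
Qed.

Lemma borel_rv_continuous d (Omega : measurableType d) (X : Omega -> B)
    (phi : B -> R) : borel_rv X -> continuous phi ->
  measurable_fun setT (phi \o X).
Proof.
move=> mX cphi; apply: (measurability _ (RGenOInfty.measurableE R)).
move=> _ [_ [a ->] <-]; rewrite setTI comp_preimage.
apply: mX; apply: sub_sigma_algebra.
by move/continuousP : cphi; apply; exact: rray_open.
Qed.

Lemma borel_rv_norm d (Omega : measurableType d) (X : Omega -> B) :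
  borel_rv X -> measurable_fun setT (fun w => `|X w|).
Proof.
move=> mX; apply: (@borel_rv_continuous _ _ X (@Num.norm R B)) => //.
exact: norm_continuous.
Qed.

Hypothesis sepB : separable_space B.

(** Separability makes countably many rectangles enough: the preimage of an open set is a countable
    union of sets on which both variables lie in small balls centred on the dense sequence. *)
Lemma borel_rvD d (Omega : measurableType d) (X Y : Omega -> B) :
  borel_rv X -> borel_rv Y -> borel_rv (fun w => X w + Y w).
Proof.
move=> mX mY; have [u du] := separable_dense_seq sepB.
apply: borel_rv_open => A oA.
pose r (n : nat) : R := n.+1%:R^-1.
(* [I] keeps the triples, two centres and a radius, whose product of balls is sent into [A] by
   addition. *)
pose I := [set t : nat * nat * nat | forall x y,
   `|x - u t.1.1| < r t.2 -> `|y - u t.1.2| < r t.2 -> A (x + y)].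
rewrite (_ : _ @^-1` _ = \bigcup_(t in I)
   (X @^-1` ball (u t.1.1) (r t.2) `&` Y @^-1` ball (u t.1.2) (r t.2))).
  rewrite bigcup_mkcond; apply: countable_bigcupT_measurable => // t.
  case: ifP => // _; apply: measurableI.
    by apply: mX; apply: sub_sigma_algebra; exact: ball_open.
  by apply: mY; apply: sub_sigma_algebra; exact: ball_open.
apply/seteqP; split => w /=.
  move=> AXY.
  have /nbhs_ballP[e e0 eA] : nbhs (X w + Y w) A by exact: open_nbhs_nbhs.
  (* A quarter of [e] for each of four distances: from [X w] and [x] to [u i], and from [Y w] and
     [y] to [u j]. *)
  have e40 : 0 < e / 4 by rewrite divr_gt0.
  have [n ne] : exists n, r n < e / 4.
    by have [n] := ltr_add_invr e40; rewrite add0r; exists n.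
  have rn0 : 0 < r n by rewrite invr_gt0.
  have [i Xi] := du (X w) _ rn0; have [j Yj] := du (Y w) _ rn0.
  exists ((i, j), n) => /=; last by rewrite -ball_normE /= ![`|u _ - _|]distrC.
  move=> x y xi yj; apply: eA; rewrite -ball_normE /=.
  rewrite opprD addrACA (le_lt_trans (ler_normD _ _))//.
  have -> : X w - x = (X w - u i) - (x - u i) by rewrite opprB addrA subrK.
  have -> : Y w - y = (Y w - u j) - (y - u j) by rewrite opprB addrA subrK.
  have := ler_normB (X w - u i) (x - u i).
  have := ler_normB (Y w - u j) (y - u j).
  lra.
move=> [t It []]; rewrite -ball_normE /= => bX bY.
by apply: It; rewrite distrC.
Qed.

Lemma borel_rv_sum d (Omega : measurableType d) I (s : seq I) (P : pred I)
    (X : I -> Omega -> B) :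
  (forall i, borel_rv (X i)) -> borel_rv (fun w => \sum_(i <- s | P i) X i w).
Proof.
move=> mX; elim: s => [|i s IH].
  by under eq_fun do rewrite big_nil; exact: borel_rv_cst.
under eq_fun do rewrite big_cons.
by case: (P i) => //; exact: borel_rvD.
Qed.

End borel_random_elements.

(** * Expectations of products of independent nonnegative functions *)

Section independent_product.
Local Open Scope ereal_scope.

(** The hypothesis on rectangles identifies the law of the pair with the product of the two laws;
    Tonelli's theorem then factors the integral. *)
Lemma indep_integral d d1 d2 (Omega : measurableType d)
    (T1 : measurableType d1) (T2 : measurableType d2) (R : realType)
    (mu : probability Omega R)
    (Z1 : Omega -> T1) (Z2 : Omega -> T2) (f : T1 -> R) (g : T2 -> R) :
  measurable_fun setT Z1 -> measurable_fun setT Z2 ->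
  (forall E F, measurable E -> measurable F ->
     mu (Z1 @^-1` E `&` Z2 @^-1` F) = mu (Z1 @^-1` E) * mu (Z2 @^-1` F)) ->
  measurable_fun setT f -> measurable_fun setT g ->
  (forall x, 0 <= f x)%R -> (forall x, 0 <= g x)%R ->
  \int[mu]_x (f (Z1 x) * g (Z2 x))%:E =
  (\int[mu]_x (f (Z1 x))%:E) * (\int[mu]_x (g (Z2 x))%:E).
Proof.
move=> mZ1 mZ2 indep mf mg f0 g0.
pose Z1' : {mfun Omega >-> T1} := HB.pack Z1 (isMeasurableFun.Build _ _ _ _ _ mZ1).
pose Z2' : {mfun Omega >-> T2} := HB.pack Z2 (isMeasurableFun.Build _ _ _ _ _ mZ2).
have mZ : measurable_fun setT (fun x => (Z1 x, Z2 x)) by exact: measurable_fun_pair.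
pose Z' : {mfun Omega >-> (T1 * T2)%type} :=
  HB.pack (fun x => (Z1 x, Z2 x)) (isMeasurableFun.Build _ _ _ _ _ mZ).
pose h (z : (T1 * T2)%type) : \bar R := (f z.1 * g z.2)%:E.
have mh : measurable_fun setT h.
  apply/measurable_EFinP/measurable_funM.
    exact: (measurableT_comp mf measurable_fst).
  exact: (measurableT_comp mg measurable_snd).
have h0 z : 0 <= h z by rewrite lee_fin mulr_ge0.
transitivity (\int[distribution mu Z']_z h z).
  by rewrite ge0_integral_distribution.
transitivity (\int[distribution mu Z1' \x distribution mu Z2']_z h z).
  apply: eq_measure_integral => A mA _.
  exact/esym/product_measure_unique.
rewrite fubini_tonelli1//.
have mg' : measurable_fun setT (EFin \o g : _ -> \bar R) by exact/measurable_EFinP.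
have mf' : measurable_fun setT (EFin \o f : _ -> \bar R) by exact/measurable_EFinP.
have -> : \int[mu]_x (f (Z1 x))%:E = \int[distribution mu Z1']_y (f y)%:E.
  by rewrite ge0_integral_distribution// => y; rewrite lee_fin.
have -> : \int[mu]_x (g (Z2 x))%:E = \int[distribution mu Z2']_y (g y)%:E.
  by rewrite ge0_integral_distribution// => y; rewrite lee_fin.
rewrite -ge0_integralZr//.
- apply: eq_integral => x _; rewrite /fubini_F /h /=.
  under eq_integral do rewrite EFinM.
  by rewrite ge0_integralZl ?lee_fin// => y _; rewrite lee_fin.
- by move=> x _; rewrite lee_fin.
- by apply: integral_ge0 => x _; rewrite lee_fin.
Qed.

End independent_product.

(** * The space of sequences and i.i.d. laws *)

Section sequence_space.
Context (R : realType) (B : completeNormedModType R).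

Definition cylinder (A : nat -> set B) : set (nat -> B) :=
  [set x | forall i, A i (x i)].

(** The bound [n] makes the cylinders finite-dimensional, so that a finite product of probabilities
    can prescribe their measure. *)
Definition borel_cylinders : set (set (nat -> B)) :=
  [set C | exists (A : nat -> set B) n, [/\ forall i, borel_set (A i),
     forall i, (n <= i)%N -> A i = setT & C = cylinder A]].

(* Laws of processes live on this space, so that every event and functional
   below is a function of the whole trajectory. *)
Definition seqspace := g_sigma_algebraType borel_cylinders.
HB.instance Definition _ := Measurable.on seqspace.

Lemma borel_setT : borel_set [set: B].
Proof. by apply: sub_sigma_algebra; exact: openT. Qed.

Lemma borel_setI (A C : set B) :
  borel_set A -> borel_set C -> borel_set (A `&` C).
Proof. exact: (@measurableI _ (g_sigma_algebraType (@open B))). Qed.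

Lemma cylinderI (A C : nat -> set B) :
  cylinder A `&` cylinder C = cylinder (fun i => A i `&` C i).
Proof.
apply/seteqP; split => x /=; first by move=> [Ax Cx] i; split; [exact: Ax|exact: Cx].
by move=> h; split => i; have [] := h i.
Qed.

Lemma setI_closed_cylinders : setI_closed borel_cylinders.
Proof.
move=> _ _ [A [n [bA An ->]]] [C [m [bC Cm ->]]].
exists (fun i => A i `&` C i), (maxn n m); split => [i|i|].
- exact: borel_setI.
- by rewrite geq_max => /andP[ni mi]; rewrite An// Cm// setIT.
- exact: cylinderI.
Qed.

Lemma borel_cylindersT : borel_cylinders setT.
Proof.
by exists (fun=> setT), 0%N; split => //; [move=> _; exact: borel_setT|
  apply/seteqP; split].
Qed.

Lemma borel_rv_coord i : borel_rv (fun x : seqspace => x i).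
Proof.
move=> A bA; apply: sub_sigma_algebra.
exists (fun j => if j == i then A else setT), i.+1; split => [j|j|].
- by case: eqP => // _; exact: borel_setT.
- by case: eqP => // ->; rewrite ltnn.
- apply/seteqP; split => x /=; first by move=> Ax j; case: eqP => // ->.
  by move=> /(_ i); rewrite eqxx.
Qed.

Lemma measurable_fun_seqspace d (Omega : measurableType d)
    (h : Omega -> seqspace) :
  (forall i, borel_rv (fun w => h w i)) -> measurable_fun setT h.
Proof.
move=> mh; apply: (@measurability _ _ Omega seqspace _ _ borel_cylinders) => //.
move=> _ [_ [A [n [bA _ ->]]] <-]; rewrite setTI.
rewrite (_ : _ @^-1` _ = \bigcap_i ((fun w => h w i) @^-1` A i)).
  by apply: bigcapT_measurable => i; exact: mh.
by apply/seteqP; split => w /= hw i; [move=> _; exact: hw|exact: hw].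
Qed.

(* Coordinates outside [D] are set to [0] instead of being dropped: sums over
   [D] are then sums of the restricted sequence. *)
Definition restr (D : pred nat) (x : seqspace) : seqspace :=
  fun i => if D i then x i else 0.

Definition shiftseq k (x : seqspace) : seqspace := fun i => x (i + k)%N.

Lemma measurable_restr D : measurable_fun setT (restr D).
Proof.
apply: measurable_fun_seqspace => i; rewrite /restr.
by case: (D i); [exact: borel_rv_coord|exact: borel_rv_cst].
Qed.

Lemma measurable_shiftseq k : measurable_fun setT (shiftseq k).
Proof. by apply: measurable_fun_seqspace => i; exact: borel_rv_coord. Qed.

(** Cylinders form a pi-system that contains the whole space, and they generate the
    sigma-algebra. *)
Lemma seqspace_measure_unique (m1 m2 : {measure set seqspace -> \bar R}) :
  (m1 setT < +oo)%E -> (forall C, borel_cylinders C -> m1 C = m2 C) ->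
  forall E, measurable E -> m1 E = m2 E.
Proof.
move=> m1oo m12 E mE.
apply: (@measure_unique _ R seqspace borel_cylinders (fun=> setT) _ _ _ _ m1 m2) => //.
- exact: setI_closed_cylinders.
- by move=> _; exact: borel_cylindersT.
- by rewrite bigcup_const//; exists 0%N.
Qed.

(** Every factor is read at coordinate [0], so one formula expresses both independence and equality
    of the marginal laws. *)
Definition iid_law (mu : set seqspace -> \bar R) :=
  forall (A : nat -> set B) n, (forall i, borel_set (A i)) ->
    (forall i, (n <= i)%N -> A i = setT) ->
    mu (cylinder A) =
    \big[*%E/1%E]_(0 <= i < n) mu [set x | A i (x 0%N)].

Section independence.
Variable mu : probability seqspace R.
Local Open Scope ereal_scope.

(** Both sides are finite measures in [F]: the image under [Z] of [mu] restricted to [H], and the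
    law of [Z] scaled by [mu H]. They need only be compared on cylinders. *)
Lemma indep_from_cylinders (H : set seqspace) (Z : seqspace -> seqspace) :
  measurable H -> measurable_fun setT Z ->
  (forall C, borel_cylinders C ->
     mu (H `&` Z @^-1` C) = mu H * mu (Z @^-1` C)) ->
  forall F, measurable F -> mu (H `&` Z @^-1` F) = mu H * mu (Z @^-1` F).
Proof.
move=> mH mZ indep F mF.
pose Z' : {mfun seqspace >-> seqspace} := HB.pack Z (isMeasurableFun.Build _ _ _ _ _ mZ).
have muH : (0 <= fine (mu H))%R by exact: fine_ge0.
pose m1' : {measure set seqspace -> \bar R} := pushforward (mrestr mu mH) Z.
pose m1 : {measure set seqspace -> \bar R} := m1' mZ.
pose m2 : {measure set seqspace -> \bar R} :=
  mscale (NngNum muH) (distribution mu Z').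
have m12 C : m1 C = m2 C <-> mu (H `&` Z @^-1` C) = mu H * mu (Z @^-1` C).
  rewrite /m1 /m1' /m2 /= /pushforward /mrestr /mscale /distribution /pushforward /=.
  by rewrite setIC fineK// fin_num_measure.
apply/m12/seqspace_measure_unique => //.
  rewrite /m1 /m1' /= /pushforward /mrestr; apply: le_lt_trans (ltry 1).
  by rewrite preimage_setT setTI; exact: probability_le1.
by move=> C cC; apply/m12; exact: indep.
Qed.

End independence.
End sequence_space.

(** * Independence of disjoint blocks and stationarity under an i.i.d. law *)

Section iid_sequence.
Context (R : realType) (B : completeNormedModType R).
Variable mu : probability (seqspace B) R.
Hypothesis iid : iid_law mu.
Local Open Scope ereal_scope.

Lemma restr_cylinder (D : pred nat) (A : nat -> set B) :
  (forall i, borel_set (A i)) ->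
  restr D @^-1` cylinder A =
    cylinder (fun i => if D i then A i else setT) \/
  restr D @^-1` cylinder A = set0.
Proof.
move=> bA; have [A0|nA0] := pselect (forall i, ~~ D i -> A i 0%R).
  left; apply/seteqP; split => x /= Ax i; have := Ax i; rewrite /restr.
    by case: (D i).
  by case: (boolP (D i)) => // /A0.
right; apply/seteqP; split => // x /= Ax; apply: nA0 => i nDi.
by have := Ax i; rewrite /restr (negbTE nDi).
Qed.

(** Cylinders suffice first for [F], then for [E]. For two cylinders the constraints bear on
    disjoint sets of coordinates, so the product formula splits. *)
Lemma restr_indep (D : pred nat) (E F : set (seqspace B)) :
  measurable E -> measurable F ->
  mu (restr D @^-1` E `&` restr (predC D) @^-1` F) =
  mu (restr D @^-1` E) * mu (restr (predC D) @^-1` F).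
Proof.
have mrestr D' G : measurable G -> measurable (restr D' @^-1` G : set (seqspace B)).
  by move=> mG; rewrite -[X in measurable X]setTI; exact: measurable_restr.
move=> mE mF; apply: indep_from_cylinders => //.
- exact: mrestr.
- exact: measurable_restr.
move=> _ [C [m [bC Cm ->]]].
have bT : borel_set [set: B] by exact: borel_setT.
have mC : measurable (cylinder C : set (seqspace B)).
  by apply: sub_sigma_algebra; exists C, m.
rewrite setIC muleC; apply: indep_from_cylinders => //.
- exact: mrestr.
- exact: measurable_restr.
move=> _ [A [n [bA An ->]]].
have [->|->] := @restr_cylinder (predC D) C bC; last by rewrite set0I measure0 mul0e.
have [->|->] := @restr_cylinder D A bA; last by rewrite setI0 measure0 mule0.
rewrite cylinderI.
(* A common length is imposed on the three products; each unconstrained coordinate contributes a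
   factor [1]. *)
rewrite !(iid (n := maxn n m)); try by [].
- rewrite -big_split /=; apply: eq_bigr => i _.
  have mT : mu [set x : seqspace B | True] = 1 by exact: probability_setT.
  case: (D i) => /=.
    rewrite mT mul1e; congr (mu _).
    by apply/seteqP; split => x //= [].
  rewrite mT mule1; congr (mu _).
  by apply/seteqP; split => x //= [].
- by move=> i; case: (D i).
- by move=> i; rewrite geq_max => /andP[ni _]; rewrite An//; case: ifP.
- by move=> i; case: ifP.
- by move=> i; rewrite geq_max => /andP[_ mi]; rewrite Cm//; case: ifP.
- by move=> i; apply: borel_setI; case: ifP.
- move=> i; rewrite geq_max => /andP[ni mi]; rewrite An// Cm//.
  by rewrite !if_same setIT.
Qed.

(** Stationarity: the preimage of a cylinder leaves the first [k] coordinates free, and these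
    contribute factors [1] to the product. *)
Lemma shiftseq_law k (E : set (seqspace B)) : measurable E ->
  mu (@shiftseq R B k @^-1` E) = mu E.
Proof.
move=> mE.
have mS : measurable_fun setT (@shiftseq R B k) := @measurable_shiftseq R B k.
pose S : {mfun seqspace B >-> seqspace B} :=
  HB.pack (@shiftseq R B k) (isMeasurableFun.Build _ _ _ _ _ mS).
apply: (@seqspace_measure_unique _ B (distribution mu S) mu) => //.
  by apply: le_lt_trans (ltry 1); exact: probability_le1.
move=> _ [A [n [bA An ->]]].
refine (etrans _ (esym (iid bA An))).
transitivity (mu (cylinder (fun i => if (i < k)%N then setT else A (i - k)%N))).
  congr (mu _); apply/seteqP; split => x /= Ax i.
    by case: ltnP => // ki; have := Ax (i - k)%N; rewrite /shiftseq subnK.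
  by have := Ax (i + k)%N; rewrite ltnNge leq_addl /= addnK.
rewrite (iid (n := (k + n)%N)).
- rewrite (big_cat_nat _ (n := k)) ?leq_addr//= big_nat_cond big1 ?mul1e.
    rewrite -{1}[k]add0n big_addn addKn; apply: eq_bigr => i _.
    by rewrite ltnNge leq_addl addnK.
  by move=> i /andP[/andP[_ ->]] _; exact: probability_setT.
- by move=> i; case: ifP => // _; exact: borel_setT.
- move=> i kni; rewrite ltnNge (leq_trans _ kni) ?leq_addr//= An//.
  by rewrite leq_subRL// (leq_trans _ kni) ?leq_addr.
Qed.

Lemma ge0_integral_shiftseq k (f : seqspace B -> \bar R) :
  measurable_fun setT f -> (forall x, 0 <= f x) ->
  \int[mu]_x f (shiftseq k x) = \int[mu]_x f x.
Proof.
move=> mf f0.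
rewrite -(@ge0_integral_pushforward _ _ _ _ _ _ (@measurable_shiftseq R B k) mu setT f)//.
apply: eq_measure_integral => [|mS A mA _]; first exact: measurable_shiftseq.
exact: shiftseq_law.
Qed.

Lemma ge0_integral_restr (D : pred nat) (f g : seqspace B -> R) :
  measurable_fun setT f -> measurable_fun setT g ->
  (forall x, 0 <= f x)%R -> (forall x, 0 <= g x)%R ->
  \int[mu]_x (f (restr D x) * g (restr (predC D) x))%:E =
  (\int[mu]_x (f (restr D x))%:E) * (\int[mu]_x (g (restr (predC D) x))%:E).
Proof.
move=> mf mg f0 g0; apply: indep_integral => //; try exact: measurable_restr.
by move=> E F mE mF; exact: restr_indep.
Qed.

End iid_sequence.

(** * Transfer from the given probability space to the space of sequences *)

Section same_law.
Context (R : realType) (B : completeNormedModType R).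
Local Open Scope ereal_scope.

Lemma integral_same_law d d' (O1 : measurableType d) (O2 : measurableType d')
    (P1 : probability O1 R) (P2 : probability O2 R) (X : O1 -> B) (Y : O2 -> B)
    (f : g_sigma_algebraType (@open B) -> \bar R) :
  borel_rv X -> borel_rv Y ->
  (forall A, borel_set A -> P1 (X @^-1` A) = P2 (Y @^-1` A)) ->
  measurable_fun setT f ->
  \int[P1]_w f (X w) = \int[P2]_w f (Y w).
Proof.
move=> mX mY XY mf.
(* The integral is the difference of those of the positive and negative parts; signed integrands
   occur for continuous functionals. *)
wlog f0 : f mf / forall x, 0 <= f x.
  move=> ge0; rewrite integralE [RHS]integralE.
  rewrite (funepos_comp f X) (funepos_comp f Y).
  rewrite (funeneg_comp f X) (funeneg_comp f Y) /comp.
  by rewrite (ge0 f^\+) ?(ge0 f^\-) //;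
    [exact: measurable_funeneg|exact: measurable_funepos].
have mX' : measurable_fun setT (X : O1 -> g_sigma_algebraType (@open B)).
  by move=> _ A mA; rewrite setTI; exact: mX.
have mY' : measurable_fun setT (Y : O2 -> g_sigma_algebraType (@open B)).
  by move=> _ A mA; rewrite setTI; exact: mY.
rewrite -(@ge0_integral_pushforward _ _ _ _ _ _ mX' P1 setT f)//.
rewrite -(@ge0_integral_pushforward _ _ _ _ _ _ mY' P2 setT f)//.
by apply: eq_measure_integral => // *; exact: XY.
Qed.

Context d (Omega : measurableType d) (P : probability Omega R).
Variables (X : Omega -> B) (Xn : nat -> Omega -> B).
Hypothesis XXn : iid_copies P X Xn.

Definition sample_path (w : Omega) : seqspace B := fun i => Xn i w.

Lemma measurable_path : measurable_fun setT sample_path.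
Proof. by apply: measurable_fun_seqspace; case: XXn. Qed.

Definition path_mfun : {mfun Omega >-> seqspace B} :=
  HB.pack sample_path (isMeasurableFun.Build _ _ _ _ _ measurable_path).

Lemma iid_law_path : iid_law (distribution P path_mfun).
Proof.
case: XXn => _ _ XnX indep A n bA An; rewrite /distribution /pushforward /=.
transitivity (\big[*%E/1%E]_(i <- iota 0 n) P (Xn i @^-1` A i)).
  rewrite -indep ?iota_uniq//; congr (P _).
  apply/seteqP; split => w /= Aw i; first by move=> _; exact: Aw.
  have [ni|ni] := leqP n i; first by rewrite An.
  by apply: Aw; rewrite /= mem_iota.
by rewrite /index_iota subn0; apply: eq_bigr => i _; rewrite XnX// -(XnX 0%N).
Qed.

Lemma integral_path (f : seqspace B -> \bar R) :
  measurable_fun setT f -> (forall x, 0 <= f x) ->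
  \int[distribution P path_mfun]_x f x = \int[P]_w f (sample_path w).
Proof. by move=> mf f0; rewrite ge0_integral_distribution. Qed.

(** [X] is not a coordinate of the path; it enters only through its law, which is that of coordinate
    [0]. *)
Lemma integral_copy (f : g_sigma_algebraType (@open B) -> \bar R) :
  measurable_fun setT f ->
  \int[P]_w f (X w) = \int[distribution P path_mfun]_x f (x 0%N).
Proof.
case: XXn => mX _ XnX _ mf.
apply: (integral_same_law (Y := fun x : seqspace B => x 0%N)) => //.
  exact: borel_rv_coord.
by move=> A bA; rewrite -(XnX 0%N).
Qed.

End same_law.

(** * Deterministic inequalities *)

Section harmonic.
Context (R : realType).
Implicit Types (y : R) (n k N : nat).

Lemma ln_succ_le_harmonic n :
  ln (1 + n%:R) <= \sum_(0 <= i < n) i.+1%:R^-1 :> R.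
Proof.
elim: n => [|n IH]; first by rewrite big_geq// addr0 ln1.
rewrite big_nat_recr//=.
have n0 : 0 < n.+1%:R :> R by [].
have -> : 1 + n.+1%:R = (1 + n%:R) * (1 + n.+1%:R^-1) :> R.
  by rewrite [X in _ = X * _]nat1r mulrDr mulr1 divff ?gt_eqF// addrC.
have hn : 0 < 1 + n%:R :> R by rewrite ltr_wpDr.
have hv : 0 < 1 + n.+1%:R^-1 :> R by rewrite ltr_wpDr.
rewrite lnM ?posrE//; apply: lerD => //.
rewrite -[leRHS]expRK ler_ln ?posrE ?expR_gt0//.
exact: expR_ge1Dx.
Qed.

(** The induction step is [1/(n+2) <= ln ((n+2)/(n+1))], that is, [ln (1 - v) <= - v] at
    [v = 1/(n+2)]. *)
Lemma harmonic_le_ln n :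
  \sum_(0 <= i < n.+1) i.+1%:R^-1 <= 1 + ln n.+1%:R :> R.
Proof.
elim: n => [|n IH]; first by rewrite big_nat1 ln1 invr1 addr0.
rewrite big_nat_recr//= (le_trans (lerD IH (lexx _)))// -addrA lerD2l.
rewrite -lerBrDl -ln_div ?posrE//.
have -> : n.+2%:R / n.+1%:R = (1 - n.+2%:R^-1)^-1 :> R.
  have n0 : n.+2%:R != 0 :> R by rewrite pnatr_eq0.
  by rewrite -[X in X - _](divff n0) -[X in _ - X]mul1r -mulrBl -[X in X - 1]natr1 addrK invf_div.
have lt1 : n.+2%:R^-1 < 1 :> R by rewrite invf_lt1// ltr1n.
rewrite lnV ?posrE ?subr_gt0// lerNr.
rewrite -[leRHS]expRK ler_ln ?posrE ?expR_gt0 ?subr_gt0//.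
exact: expR_ge1Dx.
Qed.

Lemma truncated_harmonic_le_ln N y : 0 <= y ->
  \sum_(0 <= i < N) (i.+1%:R <= y)%R%:R / i.+1%:R <= 1 + ln (1 + y).
Proof.
move=> y0; elim: N => [|N IH].
  by rewrite big_geq// addr_ge0// ln_ge0// lerDl.
(* The index [N] adds something only if [N + 1 <= y]; the sum is then at most the full harmonic sum
   of order [N + 1], hence at most [1 + ln (N + 1)]. *)
rewrite big_nat_recr//=; case: (leP N.+1%:R y) => [Ny|]; last by rewrite mul0r addr0.
apply: (@le_trans _ _ (\sum_(0 <= i < N.+1) i.+1%:R^-1)).
  rewrite big_nat_recr//= mul1r lerD2r; apply: ler_sum => i _.
  by case: (_ <= y); rewrite ?mul1r ?mul0r// invr_ge0.
rewrite (le_trans (harmonic_le_ln N))// lerD2l ler_ln ?posrE//; lra.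
Qed.

Lemma sum_inv_sqr_le k N :
  \sum_(k <= m < N) (m.+1%:R ^- 2) <= 2 / k.+1%:R :> R.
Proof.
have [Nk|kN] := leqP N k; first by rewrite big_geq// divr_ge0.
(* The subtracted [1/N] closes the induction, because [1/(n+1)^2 <= 1/n - 1/(n+1)]. *)
suff : \sum_(k <= m < N) (m.+1%:R ^- 2) <= 2 / k.+1%:R - N%:R^-1 :> R.
  by move=> /le_trans; apply; rewrite gerBl invr_ge0.
rewrite -(subnKC kN); elim: (N - k.+1)%N => [|j IH].
  rewrite addn0 big_nat1.
  have k0 : 0 < k.+1%:R :> R by [].
  rewrite (_ : _ - _ = k.+1%:R^-1); last by field; rewrite gt_eqF.
  by rewrite lef_pV2 ?posrE ?exprn_gt0// expr2 ler_pMl// ler1n.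
rewrite addnS big_nat_recr/=; last by rewrite addSn ltnW// ltnS leq_addr.
apply: (le_trans (lerD IH (lexx _))).
rewrite -addrA lerD2l addrC -lerBrDr opprK.
have n0 : 0 < (k.+1 + j)%:R :> R by rewrite addSn.
rewrite -natr1; set n := (k.+1 + j)%:R in n0 *.
have n1 : 0 < n + 1 by rewrite addr_gt0.
rewrite (_ : - _ + _ = (n * (n + 1))^-1); last by field; rewrite !gt_eqF.
by rewrite lef_pV2 ?posrE ?mulr_gt0 ?exprn_gt0// expr2 ler_pM2r// lerDl.
Qed.

End harmonic.

(** * First hitting times *)

Section first_hit.
Variable f : pred nat.

Definition first_hit k := f k && ~~ has f (iota 0 k).

Lemma sum_first_hit (R : realType) N :
  \sum_(0 <= k < N) (first_hit k)%:R = (has f (iota 0 N))%:R :> R.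
Proof.
elim: N => [|N IH]; first by rewrite big_geq.
rewrite big_nat_recr// IH -[N.+1]addn1 iotaD has_cat /= orbF add0n /first_hit.
by case: has; case: f => /=; rewrite ?addr0 ?add0r.
Qed.

Lemma exists_first_hit N : has f (iota 0 N) ->
  exists2 k, (k < N)%N & first_hit k.
Proof.
elim: N => // N IH; rewrite -[X in iota 0 X]addn1 iotaD has_cat /= orbF add0n.
case: (boolP (has f (iota 0 N))) => [/IH[k kN fk] _|nh /= fN].
  by exists k => //; exact: ltnW.
by exists N => //; rewrite /first_hit fN.
Qed.

End first_hit.

(** * Partial sums and the pathwise bound obtained by stopping *)

Section partial_sums.
Context (R : realType) (B : completeNormedModType R).
Implicit Types (x : seqspace B) (n m k N : nat) (c : R).

Definition psum n x : B := \sum_(0 <= i < n) x i.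

Definition nsum n x : R := \sum_(0 <= i < n) `|x i|.

(* The paper's index n is [m.+1]. *)
Definition wsum N x : R := \sum_(0 <= m < N) `|psum m.+1 x| / m.+1%:R ^+ 2.

(** Up to an additive [1] this dominates every [|x k| / (k+1)] with [k < N], and, being a sum, it
    has a mean that can be computed term by term. *)
Definition large_part N x : R :=
  \sum_(0 <= i < N) (i.+1%:R <= `|x i|)%R%:R * `|x i| / i.+1%:R.

(* Stopping also on the averages of the norms controls [`|psum k x| / k] at the
   stopping time, which the bound on [wsum] alone does not. *)
Definition hit c x k := (c < wsum k.+1 x) || (c * k.+1%:R < nsum k.+1 x).

Definition upto k : pred nat := fun i => (i <= k)%N.

(** Evaluated at a sequence whose coordinates up to [k] are zeroed, it becomes the weighted sum of
    the norms of the increments after the stopping time; its term [m = k] is then [0]. *)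
Definition after k N x : R := \sum_(k <= m < N) `|psum m.+1 x| / m.+1%:R ^+ 2.

Lemma norm_psum_le n x : `|psum n x| <= nsum n x.
Proof. exact: ler_norm_sum. Qed.

Lemma psum_upto k n x : (n <= k.+1)%N -> psum n (restr (upto k) x) = psum n x.
Proof.
move=> nk; apply: eq_big_nat => i /andP[_ ni].
by rewrite /restr /upto -ltnS (leq_trans ni nk).
Qed.

Lemma nsum_upto k n x : (n <= k.+1)%N -> nsum n (restr (upto k) x) = nsum n x.
Proof.
move=> nk; apply: eq_big_nat => i /andP[_ ni].
by rewrite /restr /upto -ltnS (leq_trans ni nk).
Qed.

Lemma hit_upto c k j x : (j <= k)%N -> hit c (restr (upto k) x) j = hit c x j.
Proof.
move=> jk; rewrite /hit nsum_upto//; congr ((_ < _) || _).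
by apply: eq_big_nat => m /andP[_ mj]; rewrite psum_upto// (leq_trans mj).
Qed.

(** Whether [k] is the first hit is decided by the coordinates up to [k], hence independently of the
    later ones. *)
Lemma first_hit_upto c k x :
  first_hit (hit c (restr (upto k) x)) k = first_hit (hit c x) k.
Proof.
rewrite /first_hit hit_upto//; congr (_ && ~~ _).
by apply: eq_in_has => j; rewrite mem_iota => /andP[_ /ltnW jk]; exact: hit_upto.
Qed.

Lemma psum_after k m x : (k <= m)%N ->
  psum m.+1 (restr (predC (upto k)) x) = psum (m - k) (shiftseq k.+1 x).
Proof.
move=> km; rewrite /psum (big_cat_nat _ (n := k.+1))//= big_nat_cond big1 ?add0r.
  rewrite -{1}[k.+1]add0n big_addn subSS; apply: eq_big_nat => i _.
  by rewrite /restr /upto /shiftseq /= -ltnNge addnS ltnS leq_addl.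
by move=> i /andP[/andP[_ ik]] _; rewrite /restr /upto /= -ltnS ik.
Qed.

Lemma psumD k m x : (k <= m)%N ->
  psum m.+1 x = psum k.+1 x + psum m.+1 (restr (predC (upto k)) x).
Proof.
move=> km; rewrite psum_after// /psum (big_cat_nat _ (n := k.+1))//=; congr (_ + _).
by rewrite -{1}[k.+1]add0n big_addn subSS.
Qed.

Lemma wsum_ge0 N x : 0 <= wsum N x.
Proof. by apply: sumr_ge0 => i _; rewrite divr_ge0// exprn_ge0. Qed.

Lemma wsum_le M N x : (M <= N)%N -> wsum M x <= wsum N x.
Proof.
move=> MN; rewrite [leRHS](big_cat_nat _ (n := M))//= lerDl.
by apply: sumr_ge0 => i _; rewrite divr_ge0// exprn_ge0.
Qed.

Lemma after_shiftseq k N x :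
  after k N (restr (predC (upto k)) x) <= wsum N (shiftseq k.+1 x).
Proof.
have [Nk|kN] := leqP N k.
  by rewrite /after big_geq// wsum_ge0.
set y := shiftseq k.+1 x.
have -> : after k N (restr (predC (upto k)) x) =
    \sum_(0 <= j < N - k) `|psum j y| / (j + k).+1%:R ^+ 2.
  rewrite /after -{1}[k]add0n big_addn; apply: eq_big_nat => j _.
  by rewrite psum_after ?leq_addl// addnK.
apply: (@le_trans _ _ (wsum (N - k.+1) y)); last by apply: wsum_le; rewrite leq_subr.
(* The term [j = 0] is an empty partial sum. Removing it aligns the indices, and each remaining
   denominator only decreases when the offset by [k] is dropped. *)
rewrite -(subnSK kN) big_nat_recl//= [psum 0 y]big_geq// normr0 mul0r add0r.
apply: ler_sum => j _; apply: ler_wpM2l => //.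
by rewrite lef_pV2 ?posrE ?exprn_gt0// lerXn2r ?nnegrE// ler_nat ltnS addSn leqW ?leq_addr.
Qed.

Lemma large_part_ge k N x : (k < N)%N -> `|x k| / k.+1%:R <= 1 + large_part N x.
Proof.
move=> kN.
have part0 i : 0 <= (i.+1%:R <= `|x i|)%R%:R * `|x i| / i.+1%:R.
  by rewrite divr_ge0// mulr_ge0.
have : (k.+1%:R <= `|x k|)%R%:R * `|x k| / k.+1%:R <= large_part N x.
  rewrite /large_part (big_cat_nat _ (n := k.+1))//= big_nat_recr//=.
  by rewrite addrAC lerDr addr_ge0// sumr_ge0.
case: (leP k.+1%:R `|x k|) => [_|/ltW xk]; first by rewrite mul1r => h; rewrite (le_trans h)// lerDr.
by rewrite !mul0r => h; apply: ler_wpDr => //; rewrite ler_pdivrMr// mul1r.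
Qed.

(** At the first hit [k], the past contributes [c]; the partial sum up to [k], frozen in the later
    terms, contributes [2 * c] plus twice [|x k| / (k+1)]; the increments remain. *)
Lemma wsum_first_hit c N x : 0 <= c ->
  wsum N x <= 3 * c + 2 * (1 + large_part N x) +
    \sum_(0 <= k < N) (first_hit (hit c x) k)%:R *
                      after k N (restr (predC (upto k)) x).
Proof.
move=> c0.
have L0 : 0 <= large_part N x.
  by apply: sumr_ge0 => i _; rewrite divr_ge0// mulr_ge0.
have after0 k y : 0 <= after k N y.
  by apply: sumr_ge0 => i _; rewrite divr_ge0// exprn_ge0.
have [|nohit] := boolP (has (hit c x) (iota 0 N)); last first.
  (* Since [hit c x k] tests [wsum k.+1], the absence of a hit at [N - 1] bounds [wsum N]. *)
  have : wsum N x <= c.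
    case: N nohit {L0 after0} => [_|N]; first by rewrite /wsum big_geq.
    move/hasPn => /(_ N); rewrite mem_iota leq0n add0n ltnS leqnn => /(_ isT).
    by rewrite negb_or -leNgt => /andP[].
  have : 0 <= \sum_(0 <= k < N) (first_hit (hit c x) k)%:R *
                      after k N (restr (predC (upto k)) x).
    by apply: sumr_ge0 => k _; rewrite mulr_ge0.
  lra.
move=> /exists_first_hit[k kN fk].
(* There is no hit at [k - 1]; for [k = 0] both sums are empty. *)
have wk : wsum k x <= c /\ nsum k x <= c * k%:R.
  case/andP: fk => _; case: k {kN} => [_|k].
    by rewrite /wsum /nsum !big_geq// mulr0.
  move/hasPn => /(_ k); rewrite mem_iota leq0n add0n ltnS leqnn => /(_ isT).
  by rewrite negb_or -!leNgt => /andP[].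
have [wkc qkc] := wk.
have k0 : 0 < k.+1%:R :> R by [].
(* Only the last coordinate can overshoot, since the norms before it are controlled by minimality of
   [k]. *)
have sk : `|psum k.+1 x| <= c * k.+1%:R + `|x k|.
  rewrite (le_trans (norm_psum_le _ _))// /nsum big_nat_recr//= lerD2r.
  by rewrite (le_trans qkc)// ler_wpM2l// ler_nat.
have split_w : wsum N x = wsum k x + after k N x.
  by rewrite /wsum (big_cat_nat _ (n := k))//= ltnW.
have tail : after k N x <= `|psum k.+1 x| * (2 / k.+1%:R) +
    after k N (restr (predC (upto k)) x).
  apply: (@le_trans _ _ (`|psum k.+1 x| * (\sum_(k <= m < N) (m.+1%:R ^- 2)) +
    after k N (restr (predC (upto k)) x))); last first.
    by rewrite lerD2r ler_wpM2l// sum_inv_sqr_le.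
  rewrite mulr_sumr -big_split /=; apply: ler_sum_nat => m /andP[km _].
  by rewrite -mulrDl ler_wpM2r ?invr_ge0 ?exprn_ge0// (psumD _ km) ler_normD.
have sk2 : `|psum k.+1 x| * (2 / k.+1%:R) <= 2 * c + 2 * (`|x k| / k.+1%:R).
  rewrite [leLHS]mulrA ler_pdivrMr// mulrDl -[2 * (_ / _) * _]mulrA divfK ?gt_eqF//.
  by have := sk; lra.
have := large_part_ge x kN.
have : after k N (restr (predC (upto k)) x) <=
    \sum_(0 <= k < N) (first_hit (hit c x) k)%:R *
                      after k N (restr (predC (upto k)) x).
  rewrite [leRHS](big_cat_nat _ (n := k.+1))//= big_nat_recr//= fk mul1r.
  rewrite addrAC lerDr addr_ge0// sumr_ge0// => i _; exact: mulr_ge0.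
have := le_trans tail (lerD sk2 (lexx _)).
rewrite split_w; move: (\sum_(0 <= k < N) _) => Sg.
move: (after k N (restr _ _)) (after k N x) (`|x k| / k.+1%:R) (large_part N x) => *.
lra.
Qed.

End partial_sums.

(** * Expectations of nonnegative functions *)

Section expectation.
Context d (T : measurableType d) (R : realType) (mu : probability T R).
Implicit Types f g : T -> R.

Definition nonneg_meas f := measurable_fun setT f /\ forall x, 0 <= f x.

Definition Ex f : \bar R := (\int[mu]_x (f x)%:E)%E.

Lemma nonneg_measD f g : nonneg_meas f -> nonneg_meas g ->
  nonneg_meas (fun x => f x + g x).
Proof.
move=> [mf f0] [mg g0]; split; first exact: measurable_funD.
by move=> x; rewrite addr_ge0.
Qed.

Lemma nonneg_measM f g : nonneg_meas f -> nonneg_meas g ->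
  nonneg_meas (fun x => f x * g x).
Proof.
move=> [mf f0] [mg g0]; split; first exact: measurable_funM.
by move=> x; rewrite mulr_ge0.
Qed.

Lemma nonneg_meas_cst (c : R) : 0 <= c -> nonneg_meas (fun=> c).
Proof. by move=> c0; split => //; exact: measurable_cst. Qed.

Lemma nonneg_meas_sum I (s : seq I) (F : I -> T -> R) :
  (forall i, nonneg_meas (F i)) -> nonneg_meas (fun x => \sum_(i <- s) F i x).
Proof.
move=> mF; split; first by apply: measurable_sum => i; case: (mF i).
by move=> x; apply: sumr_ge0 => i _; case: (mF i).
Qed.

Lemma nonneg_meas_bool (b : T -> bool) : measurable_fun setT b ->
  nonneg_meas (fun x => (b x)%:R).
Proof.
move=> mb; split=> //.
rewrite (_ : (fun _ => _) = fun x => if b x then 1 else 0).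
  by apply: measurable_fun_ifT => //; exact: measurable_cst.
by apply/funext => x; case: (b x).
Qed.

Lemma Ex_ge0 f : nonneg_meas f -> (0 <= Ex f)%E.
Proof. by move=> [_ f0]; apply: integral_ge0 => x _; rewrite lee_fin. Qed.

Lemma le_Ex f g : nonneg_meas f -> measurable_fun setT g ->
  (forall x, f x <= g x) -> (Ex f <= Ex g)%E.
Proof.
move=> [mf f0] mg fg; apply: ge0_le_integral => //.
all: first [exact/measurable_EFinP | by move=> x _; rewrite lee_fin].
Qed.

Lemma ExD f g : nonneg_meas f -> nonneg_meas g ->
  Ex (fun x => f x + g x) = (Ex f + Ex g)%E.
Proof.
move=> [mf f0] [mg g0]; rewrite /Ex; under eq_integral do rewrite EFinD.
rewrite ge0_integralD//.
all: first [exact/measurable_EFinP | by move=> x _; rewrite lee_fin].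
Qed.

Lemma ExZ (c : R) f : 0 <= c -> nonneg_meas f ->
  Ex (fun x => c * f x) = (c%:E * Ex f)%E.
Proof.
move=> c0 [mf f0]; rewrite /Ex; under eq_integral do rewrite EFinM.
rewrite ge0_integralZl_EFin//.
all: first [exact/measurable_EFinP | by move=> x _; rewrite lee_fin].
Qed.

Lemma Ex_sum I (s : seq I) (F : I -> T -> R) :
  (forall i, nonneg_meas (F i)) ->
  Ex (fun x => \sum_(i <- s) F i x) = (\sum_(i <- s) Ex (F i))%E.
Proof.
move=> mF; rewrite /Ex; under eq_integral do rewrite -sumEFin.
rewrite ge0_integral_sum//.
- by move=> i; apply/measurable_EFinP; case: (mF i).
- by move=> i x _; rewrite lee_fin; case: (mF i).
Qed.

Lemma Ex_cst (c : R) : Ex (fun=> c) = c%:E.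
Proof. by rewrite /Ex integral_cst//= probability_setT mule1. Qed.

Lemma eq_Ex f g : f =1 g -> Ex f = Ex g.
Proof. by move=> fg; apply: eq_integral => x _; rewrite fg. Qed.

Lemma Ex_indic (A : set T) : measurable A -> Ex (\1_A) = mu A.
Proof. by move=> mA; rewrite /Ex integral_indic// setIT. Qed.

End expectation.

(** * Measurability of the functionals of the path *)

Section measurability_partial_sums.
Context (R : realType) (B : completeNormedModType R).
Hypothesis sepB : separable_space B.
Local Notation T := (seqspace B).

Lemma nonneg_meas_norm_coord i : nonneg_meas (fun x : T => `|x i|).
Proof. by split => //; exact: borel_rv_norm (@borel_rv_coord R B i). Qed.

Lemma borel_psum n : borel_rv (fun x : T => psum n x).
Proof. by apply: borel_rv_sum => // i; exact: borel_rv_coord. Qed.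

Lemma nonneg_meas_psum n : nonneg_meas (fun x : T => `|psum n x|).
Proof. by split => //; exact: borel_rv_norm (borel_psum n). Qed.

Lemma nonneg_meas_nsum n : nonneg_meas (fun x : T => nsum n x).
Proof. by apply: nonneg_meas_sum => i; exact: nonneg_meas_norm_coord. Qed.

Lemma nonneg_meas_psum_sqr m : nonneg_meas (fun x : T => `|psum m.+1 x| / m.+1%:R ^+ 2).
Proof.
apply: nonneg_measM; first exact: nonneg_meas_psum.
by apply: nonneg_meas_cst; rewrite invr_ge0 exprn_ge0.
Qed.

Lemma nonneg_meas_wsum N : nonneg_meas (fun x : T => wsum N x).
Proof. by apply: nonneg_meas_sum => i; exact: nonneg_meas_psum_sqr. Qed.

Lemma nonneg_meas_after k N : nonneg_meas (fun x : T => after k N x).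
Proof. by apply: nonneg_meas_sum => i; exact: nonneg_meas_psum_sqr. Qed.

Lemma nonneg_meas_large_term i :
  nonneg_meas (fun x : T => (i.+1%:R <= `|x i|)%R%:R * `|x i| / i.+1%:R).
Proof.
apply: nonneg_measM; last by apply: nonneg_meas_cst; rewrite invr_ge0.
apply: nonneg_measM; last exact: nonneg_meas_norm_coord.
apply: nonneg_meas_bool; apply: measurable_fun_ler => //.
by case: (nonneg_meas_norm_coord i).
Qed.

Lemma nonneg_meas_large_part N : nonneg_meas (fun x : T => large_part N x).
Proof. by apply: nonneg_meas_sum => i; exact: nonneg_meas_large_term. Qed.

Lemma measurable_fun_has (b : T -> pred nat) (s : seq nat) :
  (forall k, measurable_fun setT (fun x => b x k)) ->
  measurable_fun setT (fun x => has (b x) s).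
Proof.
move=> mb; elim: s => [|k s IH] /=; first exact: measurable_cst.
exact: measurable_or.
Qed.

Lemma measurable_hit c k : measurable_fun setT (fun x : T => hit c x k).
Proof.
apply: measurable_or; apply: measurable_fun_ltr => //.
  by case: (nonneg_meas_wsum k.+1).
by case: (nonneg_meas_nsum k.+1).
Qed.

Lemma nonneg_meas_first_hit c k :
  nonneg_meas (fun x : T => (first_hit (hit c x) k)%:R : R).
Proof.
apply: nonneg_meas_bool; apply: measurable_and; first exact: measurable_hit.
by apply: measurable_neg; apply: measurable_fun_has => j; exact: measurable_hit.
Qed.

End measurability_partial_sums.

(** * Hopf's maximal inequality *)

Section maximal_ergodic.
Context (R : realType) (B : completeNormedModType R).
Variable mu : probability (seqspace B) R.
Hypothesis iid : iid_law mu.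
Local Notation T := (seqspace B).
Variable c : R.
Hypothesis c0 : 0 <= c.

(* [excess K x] is the maximum over [0 <= k <= K] of [nsum k x - c * k]. *)
Fixpoint excess K (x : T) : R :=
  if K is K'.+1 then Num.max 0 (`|x 0%N| - c + excess K' (shiftseq 1 x)) else 0.

Lemma nonneg_meas_excess K : nonneg_meas (excess K).
Proof.
elim: K => [|K [mK K0]]; first exact: nonneg_meas_cst.
split => [|x]; last by rewrite le_max lexx.
apply: measurable_maxr; first exact: measurable_cst.
apply: measurable_funD.
  by apply: measurable_funB => //; case: (nonneg_meas_norm_coord B 0).
exact: measurableT_comp mK (@measurable_shiftseq _ _ _).
Qed.

Lemma excess_leS K x : excess K x <= excess K.+1 x.
Proof.
elim: K x => [|K IH] x; first by rewrite le_max lexx.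
rewrite [excess K.+1 x]/= [excess K.+2 x]/=.
by rewrite ge_max le_max lexx /= le_max lerD2l IH orbT.
Qed.

Lemma nsum_shiftseq k (x : T) : nsum k.+1 x = `|x 0%N| + nsum k (shiftseq 1 x).
Proof.
rewrite /nsum big_nat_recl//; congr (_ + _).
by apply: eq_bigr => i _; rewrite /shiftseq addn1.
Qed.

Lemma nsum_le_excess K k x : (k <= K)%N -> nsum k x - c * k%:R <= excess K x.
Proof.
elim: K k x => [|K IH] [|k] x //; rewrite ?mulr0 ?subr0.
- by rewrite /nsum big_geq.
- by rewrite /nsum big_geq// le_max lexx.
rewrite ltnS => kK; rewrite nsum_shiftseq /= le_max; apply/orP; right.
have := IH k (shiftseq 1 x) kK; rewrite -natr1 mulrDr mulr1; lra.
Qed.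

Lemma excess_le_nsum K x : excess K x <= nsum K x.
Proof.
elim: K x => [|K IH] x; first by rewrite /nsum big_geq.
rewrite nsum_shiftseq /= ge_max; apply/andP; split.
  by rewrite addr_ge0// sumr_ge0.
have := IH (shiftseq 1 x); move: c0; lra.
Qed.

Lemma Ex_shiftseq k (f : T -> R) : nonneg_meas f ->
  Ex mu (fun x => f (shiftseq k x)) = Ex mu f.
Proof.
move=> [mf f0]; apply: (ge0_integral_shiftseq iid k (f := EFin \o f)).
  exact/measurable_EFinP.
by move=> x; rewrite lee_fin.
Qed.

Lemma Ex_norm_coord (f : B -> R) i : nonneg_meas (fun x : T => f (x 0%N)) ->
  Ex mu (fun x => f (x i)) = Ex mu (fun x => f (x 0%N)).
Proof. by move=> mf; rewrite -(Ex_shiftseq i mf). Qed.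

Lemma Ex_nsum n : Ex mu (fun x => nsum n x) = (n%:R%:E * Ex mu (fun x : T => `|x 0%N|)%R)%E.
Proof.
rewrite Ex_sum; last exact: nonneg_meas_norm_coord.
rewrite (eq_bigr (fun=> Ex mu (fun x : T => `|x 0%N|)%R)); last first.
  by move=> i _; rewrite (@Ex_norm_coord (@Num.norm R B))//; exact: nonneg_meas_norm_coord.
by rewrite big_const_nat subn0 iter_addr_0 mule_natl.
Qed.

(** Garsia's argument: pointwise, [excess N] plus [c] on the event is at most the norm of coordinate
    [0] plus [excess N] of the shifted sequence. By stationarity the two excesses have the same
    mean, which cancels. *)
Lemma maximal_ergodic_inequality N : (Ex mu (fun x : T => `|x 0%N|)%R < +oo)%E ->
  (c%:E * Ex mu (fun x => (has (fun k => c * k.+1%:R < nsum k.+1 x)%R (iota 0 N))%:R)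
   <= Ex mu (fun x : T => `|x 0%N|)%R)%E.
Proof.
move=> foo.
pose G (x : T) := has (fun k => c * k.+1%:R < nsum k.+1 x) (iota 0 N).
have mG : nonneg_meas (fun x : T => (G x)%:R : R).
  apply: nonneg_meas_bool; apply: measurable_fun_has => k.
  by apply: measurable_fun_ltr => //; case: (nonneg_meas_nsum B k.+1).
have mE := nonneg_meas_excess N.
have mN := nonneg_meas_norm_coord B 0.
have mS : nonneg_meas (fun x => excess N (shiftseq 1 x)).
  split => [|x]; last by case: mE.
  by apply: measurableT_comp (@measurable_shiftseq _ _ _); case: mE.
(* Finiteness of this mean is what permits the cancellation at the end. *)
have fin : Ex mu (excess N) \is a fin_num.
  rewrite ge0_fin_numE ?Ex_ge0//.
  apply: (@le_lt_trans _ _ (Ex mu (fun x => nsum N x))).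
    by apply: le_Ex => //; [case: (nonneg_meas_nsum B N)|move=> x; exact: excess_le_nsum].
  by rewrite Ex_nsum lte_mul_pinfty.
(* On [G] the maximum defining [excess N.+1 x] is positive, hence equal to its
   second argument, which produces the term [- c]. *)
have : (Ex mu (fun x => excess N x + c * (G x)%:R)%R <=
        Ex mu (fun x : T => `|x 0%N| + excess N (shiftseq 1 x))%R)%E.
  apply: le_Ex.
  - by apply: nonneg_measD => //; apply: nonneg_measM => //; exact: nonneg_meas_cst.
  - by case: (nonneg_measD mN mS).
  move=> x; have lS := excess_leS N x.
  case: (boolP (G x)) => [/hasP[k]|_]; last first.
    rewrite mulr0 addr0 (le_trans lS)//= ge_max.
    have [_ /(_ x) S0] := mS.
    by rewrite addr_ge0//= lerD2r; move: c0; lra.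
  rewrite mem_iota add0n => /andP[_ kN] ck.
  have := nsum_le_excess x (kN : (k.+1 <= N)%N); move=> e1.
  have e2 : 0 < excess N.+1 x by move: lS e1 ck; lra.
  move: e2 lS; rewrite /= lt_max ltxx /= => e2.
  by rewrite (max_idPr (ltW e2)) mulr1; lra.
have mcG : nonneg_meas (fun x => c * (G x)%:R).
  by apply: nonneg_measM => //; exact: nonneg_meas_cst.
rewrite ExD// ExD// Ex_shiftseq// ExZ// [leRHS]addeC.
by rewrite leeD2lE.
Qed.

End maximal_ergodic.

(** * Sufficiency *)

Section moment_bound.
Context (R : realType) (B : completeNormedModType R).
Hypothesis sepB : separable_space B.
Variable mu : probability (seqspace B) R.
Hypothesis iid : iid_law mu.
Local Notation T := (seqspace B).
Local Notation EX := (Ex mu (fun x : T => `|x 0%N|)%R).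
Local Notation EXlog := (Ex mu (fun x : T => `|x 0%N| * ln (1 + `|x 0%N|))%R).

Lemma nonneg_meas_log :
  nonneg_meas (fun x : T => `|x 0%N| * ln (1 + `|x 0%N|)).
Proof.
have [mN _] := nonneg_meas_norm_coord B 0.
apply: nonneg_measM; first by split.
split => [|x]; last by rewrite ln_ge0// lerDl.
apply: measurableT_comp (@measurable_ln R) _.
by apply: measurable_funD => //; exact: measurable_cst.
Qed.

(** Either [1 + y >= e], so that the logarithm is at least [1], or [y < e]. Thus the logarithmic
    moment controls the first moment. *)
Lemma le_add_mul_ln (y : R) : 0 <= y -> y <= expR 1 + y * ln (1 + y).
Proof.
move=> y0; have y1 : 0 < 1 + y by rewrite ltr_pwDl.
have [ey|ye] := leP (expR 1) (1 + y).
  have l1 : 1 <= ln (1 + y) by rewrite -[X in X <= _](expRK 1) ler_ln ?posrE ?expR_gt0.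
  by rewrite ler_wpDl ?expR_ge0// ler_peMr.
have : 0 <= y * ln (1 + y) by rewrite mulr_ge0// ln_ge0// lerDl.
lra.
Qed.

Lemma EX_lt_pinfty : (EXlog < +oo)%E -> (EX < +oo)%E.
Proof.
move=> fin.
have mL := nonneg_meas_log.
have mE : nonneg_meas (fun _ : T => expR 1 : R) by apply: nonneg_meas_cst; exact: expR_ge0.
apply: (@le_lt_trans _ _ (Ex mu (fun x : T => expR 1 + `|x 0%N| * ln (1 + `|x 0%N|))%R)).
  apply: le_Ex; first exact: nonneg_meas_norm_coord.
    by apply: measurable_funD; [exact: measurable_cst|case: mL].
  by move=> x; exact: le_add_mul_ln.
rewrite (ExD _ mE mL).
by rewrite Ex_cst lte_add_pinfty// ltry.
Qed.

(** Equality of laws replaces coordinate [i] by coordinate [0]; what multiplies its norm is then a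
    harmonic sum truncated at that norm, at most [1 + ln (1 + |x 0|)]. *)
Lemma Ex_large_part_le N :
  (Ex mu (fun x : T => large_part N x)%R <= EX + EXlog)%E.
Proof.
have mT := @nonneg_meas_large_term R B.
have mN := nonneg_meas_norm_coord B 0.
pose F i (x : T) : R := (i.+1%:R <= `|x 0%N|)%R%:R * `|x 0%N| / i.+1%:R.
have mF i : nonneg_meas (F i).
  rewrite /F; apply: nonneg_measM; last by apply: nonneg_meas_cst; rewrite invr_ge0.
  apply: nonneg_measM => //; apply: nonneg_meas_bool.
  by apply: measurable_fun_ler => //; case: mN.
rewrite Ex_sum//.
under eq_bigr => i _ do rewrite (@Ex_norm_coord _ _ _ iid
  (fun b : B => (i.+1%:R <= `|b|)%R%:R * `|b| / i.+1%:R) i (mF i)).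
rewrite -Ex_sum// -ExD//; last exact: nonneg_meas_log.
apply: le_Ex; first exact: nonneg_meas_sum.
  by case: (nonneg_measD mN nonneg_meas_log).
move=> x; rewrite -[X in X + _]mulr1 -mulrDr.
rewrite (le_trans _ (ler_wpM2l _ (truncated_harmonic_le_ln N _)))//.
by rewrite mulr_sumr; apply: ler_sum => i _; rewrite mulrCA mulrA.
Qed.

Lemma Ex_restr (D : pred nat) (f g : T -> R) :
  nonneg_meas f -> nonneg_meas g ->
  Ex mu (fun x => f (restr D x) * g (restr (predC D) x))%R =
  (Ex mu (fun x => f (restr D x))%R * Ex mu (fun x => g (restr (predC D) x))%R)%E.
Proof. by move=> [mf f0] [mg g0]; exact: ge0_integral_restr. Qed.

(** The two factors depend on complementary sets of coordinates, so the mean of the product splits;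
    stationarity bounds the second mean by that of [wsum N]. *)
Lemma Ex_first_hit_after c k N :
  (Ex mu (fun x => (first_hit (hit c x) k)%:R *
                   after k N (restr (predC (upto k)) x))%R
   <= Ex mu (fun x => (first_hit (hit c x) k)%:R)%R * Ex mu (fun x => wsum N x)%R)%E.
Proof.
have [mf f0] := nonneg_meas_first_hit sepB c k.
have [ma a0] := nonneg_meas_after sepB k N.
have mw := nonneg_meas_wsum sepB N.
under eq_Ex do rewrite -first_hit_upto.
rewrite (@Ex_restr (upto k) (fun x => (first_hit (hit c x) k)%:R) (after k N)) //.
rewrite lee_pmul//.
- by apply: integral_ge0 => x _; rewrite lee_fin.
- by apply: integral_ge0 => x _; rewrite lee_fin.
- by under [leRHS]eq_Ex do rewrite -first_hit_upto.
rewrite -(Ex_shiftseq iid k.+1 mw); apply: le_Ex.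
- split => //; apply: measurableT_comp => //; exact: measurable_restr.
- by apply: measurableT_comp (@measurable_shiftseq _ _ _); case: mw.
- by move=> x; exact: after_shiftseq.
Qed.

(** The pathwise bound is integrated; the first-hit probabilities add up to the probability of a hit
    before [N]. *)
Lemma Ex_wsum_le c N : 0 <= c ->
  (Ex mu (fun x => wsum N x)%R <=
   (3 * c)%:E + 2%:E * (1 + Ex mu (fun x => large_part N x)%R) +
   Ex mu (fun x => (has (hit c x) (iota 0 N))%:R)%R * Ex mu (fun x => wsum N x)%R)%E.
Proof.
move=> c0.
have mL := nonneg_meas_large_part B N.
have mA k : nonneg_meas (fun x : T => (first_hit (hit c x) k)%:R *
                   after k N (restr (predC (upto k)) x)).
  apply: nonneg_measM; first exact: nonneg_meas_first_hit.
  have [ma a0] := nonneg_meas_after sepB k N.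
  split => //; apply: measurableT_comp => //; exact: measurable_restr.
have m1 : nonneg_meas (fun _ : T => 1 : R) by exact: nonneg_meas_cst.
have m1L : nonneg_meas (fun x : T => 1 + large_part N x).
  by apply: nonneg_measD => //; exact: nonneg_meas_cst.
have m2L : nonneg_meas (fun x : T => 2 * (1 + large_part N x)).
  by apply: nonneg_measM => //; exact: nonneg_meas_cst.
have mc : nonneg_meas (fun x : T => 3 * c) by apply: nonneg_meas_cst; rewrite mulr_ge0.
have ms : nonneg_meas (fun x : T => \sum_(0 <= k < N) (first_hit (hit c x) k)%:R *
                   after k N (restr (predC (upto k)) x)).
  exact: nonneg_meas_sum.
apply: (@le_trans _ _ (Ex mu (fun x => 3 * c + 2 * (1 + large_part N x) +
    \sum_(0 <= k < N) (first_hit (hit c x) k)%:R *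
                      after k N (restr (predC (upto k)) x))%R)).
  apply: le_Ex; first exact: nonneg_meas_wsum.
    by case: (nonneg_measD (nonneg_measD mc m2L) ms).
  by move=> x; exact: wsum_first_hit.
rewrite ExD//; last exact: nonneg_measD.
rewrite ExD// Ex_cst ExZ// (ExD _ m1 mL).
rewrite Ex_cst leeD// Ex_sum//.
under [X in (_ <= X * _)%E]eq_Ex do rewrite -sum_first_hit.
rewrite Ex_sum; last by move=> k; exact: nonneg_meas_first_hit.
rewrite ge0_sume_distrl; last by move=> k _; rewrite Ex_ge0//; exact: nonneg_meas_first_hit.
by apply: lee_sum => k _; exact: Ex_first_hit_after.
Qed.

(** The events [F n], that some partial series exceeds [n], decrease to the divergence event, which
    is null. Continuity from above then gives a threshold valid for all [N] at once. *)
Lemma wsum_tail :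
  {ae mu, forall x : T, (\sum_(0 <= m <oo) (`|psum m.+1 x| / m.+1%:R ^+ 2)%:E < +oo)%E} ->
  exists n0 : nat, forall (c : R) N, n0%:R <= c ->
    (Ex mu (fun x => (c < wsum N x)%R%:R)%R <= (4^-1)%:E)%E.
Proof.
move=> ae_fin.
pose F (n : nat) : set T := \bigcup_N [set x : T | n%:R < wsum N x].
have mW n N : measurable [set x : T | n%:R < wsum N x].
  have := measurable_fun_ltr (measurable_cst (n%:R : R)) (nonneg_meas_wsum sepB N).1.
  move=> /(_ measurableT [set true]); rewrite setTI; exact.
have mF n : measurable (F n) by exact: bigcupT_measurable.
have mcap : measurable (\bigcap_n F n) by exact: bigcapT_measurable.
have Fcvg : mu \o F @ \oo --> mu (\bigcap_n F n).
  apply: nonincreasing_cvg_mu => //.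
    by apply: le_lt_trans (ltry 1); exact: probability_le1.
  move=> m n mn; apply/subsetPset => x [N _ /= h]; exists N => //=.
  by rewrite (le_lt_trans _ h)// ler_nat.
have cap0 : mu (\bigcap_n F n) = 0%E.
  apply: measure_negligible => //; apply: negligibleS ae_fin => x Fx /=.
  move=> Vfin.
  set V := (\sum_(0 <= m <oo) _)%E in Vfin.
  have V0 : (0 <= V)%E.
    by apply: nneseries_ge0 => m _ _; rewrite lee_fin divr_ge0// exprn_ge0.
  have Vf : V \is a fin_num by rewrite ge0_fin_numE.
  (* This threshold lies above the finite value of the series, which no partial series exceeds. *)
  have [N _ /=] := Fx (Num.truncn (fine V)).+1 I.
  apply/negP; rewrite -leNgt.
  apply: (@le_trans _ _ (fine V)); last by rewrite ltW// truncnS_gt.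
  rewrite -lee_fin fineK// /wsum -sumEFin.
  by apply: nneseries_lim_ge => m _ _; rewrite lee_fin divr_ge0// exprn_ge0.
rewrite cap0 in Fcvg.
have : \forall n \near \oo, (mu (F n) < (4^-1)%:E)%E.
  have := Fcvg [set y | (y < (4^-1)%:E)%E]; apply.
  apply: open_nbhs_nbhs; split; first exact: open_ereal_lt_ereal.
  by rewrite /= lte_fin.
move=> [n0 _ hn0]; exists n0 => c N n0c.
apply: (@le_trans _ _ (mu (F n0))); last by apply/ltW/hn0 => /=.
rewrite -Ex_indic//; apply: le_Ex.
- apply: nonneg_meas_bool; apply: measurable_fun_ltr => //.
  by case: (nonneg_meas_wsum sepB N).
- exact: measurable_indic.
move=> x; rewrite indicE; case: (ltP c (wsum N x)) => //= cw.
by rewrite mem_set//; exists N => //=; exact: le_lt_trans cw.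
Qed.

Lemma Ex_wsum_bounded :
  {ae mu, forall x : T, (\sum_(0 <= m <oo) (`|psum m.+1 x| / m.+1%:R ^+ 2)%:E < +oo)%E} ->
  (EXlog < +oo)%E ->
  exists C : R, forall N, (Ex mu (fun x => wsum N x)%R <= C%:E)%E.
Proof.
move=> ae_fin fin.
have finX := EX_lt_pinfty fin.
have mN := nonneg_meas_norm_coord B 0.
have mlog := nonneg_meas_log.
have eX0 : (0 <= EX)%E by exact: Ex_ge0.
have eXl0 : (0 <= EXlog)%E by exact: Ex_ge0.
have EXE : EX = (fine EX)%:E by rewrite fineK// ge0_fin_numE.
have EXlE : EXlog = (fine EXlog)%:E by rewrite fineK// ge0_fin_numE.
set e := fine EX in EXE; set l := fine EXlog in EXlE.
have e0 : 0 <= e by rewrite -lee_fin -EXE.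
have [n0 tail] := wsum_tail ae_fin.
(* [n0] makes the tail of [wsum] at most [1/4], [4 * e] makes the maximal inequality give
   [e / c <= 1/4], and [1] keeps [c] positive. *)
pose c : R := n0%:R + 4 * e + 1.
have n00 : 0 <= n0%:R :> R by [].
have c0 : 0 < c by rewrite /c; lra.
(* With hitting probability at most [1/2], the mean [r] satisfies [r <= A + r / 2], whence
   [r <= 2 * A]. *)
exists (2 * (3 * c + 2 * (1 + (e + l)))) => N.
pose p := Ex mu (fun x => (has (hit c x) (iota 0 N))%:R)%R.
have mhasq : nonneg_meas (fun x : T =>
    (has (fun k => c * k.+1%:R < nsum k.+1 x) (iota 0 N))%:R : R).
  apply: nonneg_meas_bool; apply: measurable_fun_has => k.
  by apply: measurable_fun_ltr => //; case: (nonneg_meas_nsum B k.+1).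
have mw : nonneg_meas (fun x : T => (c < wsum N x)%R%:R : R).
  apply: nonneg_meas_bool; apply: measurable_fun_ltr => //.
  by case: (nonneg_meas_wsum sepB N).
have q_le : (Ex mu (fun x => (has (fun k => c * k.+1%:R < nsum k.+1 x) (iota 0 N))%:R)%R
    <= (4^-1)%:E)%E.
  have := maximal_ergodic_inequality iid (ltW c0) N finX; rewrite EXE.
  rewrite -lee_pdivlMl// -EFinM => /le_trans; apply; rewrite lee_fin.
  by rewrite ler_pdivrMl// /c; lra.
have p_le : (p <= (2^-1)%:E)%E.
  apply: (@le_trans _ _ (Ex mu (fun x => (c < wsum N x)%R%:R +
     (has (fun k => c * k.+1%:R < nsum k.+1 x) (iota 0 N))%:R)%R)).
    apply: le_Ex.
    - apply: nonneg_meas_bool; apply: measurable_fun_has => k; exact: measurable_hit.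
    - by case: (nonneg_measD mw mhasq).
    move=> x; case: hasP => [[k kN]|_]; last by rewrite addr_ge0.
    rewrite mem_iota add0n in kN; case/andP: kN => _ kN.
    case/orP => [cw|cq].
      by rewrite (lt_le_trans cw) ?wsum_le// lerDl.
    have -> : has (fun k => c * k.+1%:R < nsum k.+1 x) (iota 0 N).
      by apply/hasP; exists k; rewrite ?mem_iota.
    by rewrite lerDr.
  rewrite ExD//; have -> : (2^-1)%:E = (4^-1)%:E + (4^-1)%:E :> \bar R.
    by rewrite -EFinD; congr _%:E; lra.
  by rewrite leeD// tail// /c; move: n00 e0; lra.
have a0 : (0 <= Ex mu (fun x => wsum N x)%R)%E by apply: Ex_ge0; exact: nonneg_meas_wsum.
(* The mean must be known to be finite for each [N] before half of it can be absorbed; the first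
   moment suffices. *)
have afin : Ex mu (fun x => wsum N x)%R \is a fin_num.
  rewrite ge0_fin_numE// Ex_sum; last by move=> i; exact: nonneg_meas_psum_sqr.
  apply: lte_sum_pinfty => i _.
  apply: (@le_lt_trans _ _ (Ex mu (fun x => nsum i.+1 x)%R)).
    apply: le_Ex; [exact: nonneg_meas_psum_sqr|by case: (nonneg_meas_nsum B i.+1)|].
    move=> x; rewrite (le_trans _ (norm_psum_le _ _))// ler_pdivrMr ?exprn_gt0//.
    by rewrite ler_peMr// exprn_ege1// ler1n.
  by rewrite Ex_nsum// EXE -EFinM ltry.
have := Ex_wsum_le N (ltW c0); rewrite -/p.
set a := Ex mu (fun x => wsum N x)%R in a0 afin *.
rewrite -(fineK afin) in a0 *; set r := fine a in a0 *.
move=> h.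
have : (r%:E <= (3 * c + 2 * (1 + (e + l)) + 2^-1 * r)%:E)%E.
  apply: (le_trans h); rewrite (EFinD _ (2^-1 * r)) (EFinD (3 * c)).
  rewrite (EFinM 2) (EFinM 2^-1) leeD//; last by rewrite lee_wpmul2r.
  apply: leeD => //; apply: lee_wpmul2l; first by rewrite lee_fin.
  rewrite (EFinD 1 (e + l)); apply: leeD => //.
  by rewrite (le_trans (Ex_large_part_le N))// EXE EXlE.
rewrite !lee_fin; lra.
Qed.

End moment_bound.

(** * Necessity *)

Section forward.
Context (R : realType) (B : completeNormedModType R).
Hypothesis sepB : separable_space B.
Variable mu : probability (seqspace B) R.
Hypothesis iid : iid_law mu.
Local Notation T := (seqspace B).
Local Notation EX := (Ex mu (fun x : T => `|x 0%N|)%R).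
Local Notation EXlog := (Ex mu (fun x : T => `|x 0%N| * ln (1 + `|x 0%N|))%R).

Lemma psum_remove1 n k (x : T) : (k < n)%N ->
  psum n x = x k + psum n (restr (predC (pred1 k)) x).
Proof.
move=> kn; rewrite /psum !big_mkord (bigD1 (Ordinal kn)) //=.
have rk : restr (predC (pred1 k)) x k = 0 by rewrite /restr /= eqxx.
rewrite [X in _ = _ + X](bigD1 (Ordinal kn)) //= rk add0r.
by congr (_ + _); apply: eq_bigr => i ik; rewrite /restr /= ifT.
Qed.

Definition big_coord a k (x : T) : R := (a <= `|x k|)%R%:R.

Lemma nonneg_meas_big_coord a k : nonneg_meas (big_coord a k).
Proof.
apply: nonneg_meas_bool; apply: measurable_fun_ler => //.
by case: (nonneg_meas_norm_coord B k).
Qed.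

(** If exactly one coordinate is large, its norm is at most that of the whole sum plus that of the
    sum without it. Otherwise each large coordinate has a large companion, and the double sum covers
    it. *)
Lemma sum_big_coord_le n a (x : T) :
  \sum_(0 <= k < n) big_coord a k x * `|x k| <=
  `|psum n x| +
  \sum_(0 <= k < n) big_coord a k x * `|psum n (restr (predC (pred1 k)) x)| +
  \sum_(0 <= k < n) \sum_(0 <= j < n)
     (j != k)%:R * (big_coord a k x * `|x k| * big_coord a j x).
Proof.
have b0 k : 0 <= big_coord a k x by rewrite ler0n.
have s1 : 0 <= \sum_(0 <= k < n) big_coord a k x * `|psum n (restr (predC (pred1 k)) x)|.
  by apply: sumr_ge0 => k _; rewrite mulr_ge0.
have s2 k : 0 <= \sum_(0 <= j < n)
     (j != k)%:R * (big_coord a k x * `|x k| * big_coord a j x).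
  by apply: sumr_ge0 => j _; rewrite !mulr_ge0.
have [[k [kn ak uniq_k]]|noneuniq] := pselect (exists k, [/\ (k < n)%N, a <= `|x k| &
    forall j, (j < n)%N -> j != k -> big_coord a j x = 0]).
  apply: (@le_trans _ _ `|x k|).
    rewrite big_mkord (bigD1 (Ordinal kn)) //= big1 ?addr0.
      by rewrite /big_coord ak mul1r.
    by move=> j jk; rewrite uniq_k ?mul0r.
  apply: ler_wpDr; first exact: sumr_ge0.
  apply: (@le_trans _ _ (`|psum n x| + big_coord a k x * `|psum n (restr (predC (pred1 k)) x)|)).
    rewrite /big_coord ak mul1r (psum_remove1 x kn).
    set y := psum n _; rewrite -{1}(addrK y (x k)); exact: ler_normB.
  rewrite lerD2l big_mkord (bigD1 (Ordinal kn)) //= lerDl.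
  by apply: sumr_ge0 => j _; rewrite mulr_ge0.
apply: ler_wpDl; first by rewrite addr_ge0.
rewrite big_nat [leRHS]big_nat; apply: ler_sum => k /andP[_ kn].
have [ak|ak] := leP a `|x k|; last first.
  have bk : big_coord a k x = 0 by rewrite /big_coord leNgt ak.
  by rewrite [X in X * _ <= _]bk mul0r; exact: s2.
have [j jn jk] : exists2 j, (j < n)%N & (j != k) && (a <= `|x j|).
  apply: contrapT => nj; apply: noneuniq; exists k; split=> // j jn jk.
  rewrite /big_coord; case: (leP a `|x j|) => // aj.
  by exfalso; apply: nj; exists j => //; rewrite jk.
rewrite big_mkord (bigD1 (Ordinal jn)) //=.
case/andP: jk => jk aj; rewrite jk mul1r [big_coord a j x]/big_coord aj mulr1 lerDl.
by apply: sumr_ge0 => i _; rewrite !mulr_ge0.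
Qed.

Hypothesis finX : (EX < +oo)%E.

(** Let [u], [p], [s], [e] be the means of the truncated norm, of its indicator, of the norm of the
    sum and of the norm. Independence gives [n u <= s + n p (s + e) + n p (n u)], and [n p <= 1/2]
    turns this into [n u <= 3 s + e]. *)
Lemma Ex_big_coord_le n (a : R) : 0 < a ->
  2 * n%:R * fine EX <= a ->
  (n%:R%:E * Ex mu (fun x => big_coord a 0 x * `|x 0%N|)%R <=
   3%:E * Ex mu (fun x => `|psum n x|)%R + EX)%E.
Proof.
move=> a0 na.
have mN := nonneg_meas_norm_coord B.
have mb := nonneg_meas_big_coord a.
have mS := nonneg_meas_psum sepB n.
have mbN k : nonneg_meas (fun x => big_coord a k x * `|x k|) by exact: nonneg_measM.
(* All means are finite, so they are named as reals and can be subtracted. *)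
have fin_le (f : T -> R) (M : \bar R) : nonneg_meas f -> (Ex mu f <= M)%E -> (M < +oo)%E ->
    exists2 r : R, 0 <= r & Ex mu f = r%:E.
  move=> mf fM Moo; exists (fine (Ex mu f)); first by rewrite fine_ge0// Ex_ge0.
  by rewrite fineK// ge0_fin_numE ?Ex_ge0// (le_lt_trans fM).
have [e e0 eE] := fin_le _ _ (mN 0%N) (lexx _) finX.
have [u u0 uE] : exists2 u : R, 0 <= u & Ex mu (fun x => big_coord a 0 x * `|x 0%N|)%R = u%:E.
  apply: (fin_le _ _ (mbN 0%N) _ finX); apply: le_Ex => //; first by case: (mN 0%N).
  by move=> x; rewrite /big_coord; case: (a <= _); rewrite ?mul1r ?mul0r.
have [p p0 pE] : exists2 p : R, 0 <= p & Ex mu (big_coord a 0) = p%:E.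
  apply: (fin_le _ 1%E (mb 0%N)); last exact: ltry.
  rewrite -[1%E](Ex_cst mu 1); apply: le_Ex => // x.
  by rewrite /big_coord; case: (a <= _).
have [s s0 sE] : exists2 s : R, 0 <= s & Ex mu (fun x => `|psum n x|)%R = s%:E.
  apply: (fin_le _ (Ex mu (fun x : T => nsum n x)%R) mS).
    by apply: le_Ex => //; [case: (nonneg_meas_nsum B n)|exact: norm_psum_le].
  by rewrite Ex_nsum// eE -EFinM ltry.
have markov : a * p <= e.
  rewrite -lee_fin EFinM -pE -ExZ ?(ltW a0)// -eE; apply: le_Ex.
  - by apply: nonneg_measM => //; apply: nonneg_meas_cst; exact: ltW.
  - by case: (mN 0%N).
  by move=> x; rewrite /big_coord; case: (leP a `|x 0%N|) => ax; rewrite ?mulr1 ?mulr0.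
(* Markov's inequality gives [a p <= e], and [2 n e <= a]; for [e = 0] it forces [p = 0] because
   [a > 0]. *)
have np : n%:R * p <= 2^-1.
  rewrite eE /= in na.
  have nep : 2 * n%:R * e * p <= e := le_trans (ler_wpM2r p0 na) markov.
  have [ez|e_neq0] := eqVneq e 0.
    have : p <= 0 by move: markov; rewrite ez pmulr_rle0.
    by move=> pz; apply: (le_trans (ler_wpM2l (ler0n _ _) pz)); rewrite mulr0.
  have egt0 : 0 < e by rewrite lt_neqAle eq_sym e_neq0.
  by rewrite -(ler_pM2r egt0); lra.
have pk k : Ex mu (big_coord a k) = p%:E.
  rewrite -pE; apply: (Ex_norm_coord iid (f := fun b : B => (a <= `|b|)%R%:R)).
  exact: mb.
have uk k : Ex mu (fun x => big_coord a k x * `|x k|)%R = u%:E.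
  rewrite -uE; apply: (Ex_norm_coord iid (f := fun b : B => (a <= `|b|)%R%:R * `|b|)).
  exact: mbN.
have restr1 k (x : T) : restr (pred1 k) x k = x k by rewrite /restr /= eqxx.
have restrN k j (x : T) : j != k -> restr (predC (pred1 k)) x j = x j.
  by move=> jk; rewrite /restr /= jk.
have b1 k x : big_coord a k (restr (pred1 k) x) = big_coord a k x.
  by rewrite /big_coord restr1.
have mR k : nonneg_meas (fun x : T => `|psum n (restr (predC (pred1 k)) x)|).
  split => //; apply: (measurableT_comp (f := fun x : T => `|psum n x|)).
    by case: mS.
  exact: measurable_restr.
(* The sum without coordinate [k] is independent of that coordinate, and its norm has mean at most
   [s + e]. *)
have t1 k : (k < n)%N ->
    (Ex mu (fun x => big_coord a k x * `|psum n (restr (predC (pred1 k)) x)|)%R <= (p * (s + e))%:E)%E.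
  move=> kn.
  rewrite (@eq_Ex _ _ _ mu _ (fun x => big_coord a k (restr (pred1 k) x) *
      `|psum n (restr (predC (pred1 k)) x)|)); last by move=> x; rewrite b1.
  rewrite (@Ex_restr _ _ _ iid (pred1 k) (big_coord a k) (fun x => `|psum n x|))//.
  rewrite (eq_Ex mu (b1 k)) pk EFinM lee_wpmul2l ?lee_fin//.
  rewrite EFinD -sE -eE -(Ex_norm_coord iid (f := @Num.norm R B) k (mN 0%N)) -ExD//.
  apply: le_Ex => //; first by case: (nonneg_measD mS (mN k)).
  move=> x; rewrite (psum_remove1 x kn).
  set y := psum n _; have -> : `|y| = `|(x k + y) - x k| by rewrite addrC addKr.
  exact: ler_normB.
have t2 k j : j != k ->
    Ex mu (fun x => big_coord a k x * `|x k| * big_coord a j x)%R = (u * p)%:E.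
  move=> jk.
  rewrite (@eq_Ex _ _ _ mu _ (fun x => (fun y : T => big_coord a k y * `|y k|) (restr (pred1 k) x) *
      big_coord a j (restr (predC (pred1 k)) x))); last first.
    by move=> x; rewrite b1 restr1 /big_coord restrN.
  rewrite (@Ex_restr _ _ _ iid (pred1 k) (fun y => big_coord a k y * `|y k|) (big_coord a j))//.
  rewrite (@eq_Ex _ _ _ mu _ (fun x => big_coord a k x * `|x k|)); last first.
    by move=> x; rewrite b1 restr1.
  rewrite uk EFinM -[in RHS](pk j); congr (_ * _)%E.
  by apply: eq_Ex => x; rewrite /big_coord restrN.
have sum_le (F : nat -> \bar R) (r : R) : (forall k, (k < n)%N -> (F k <= r%:E)%E) ->
    (\sum_(0 <= k < n) F k <= (n%:R * r)%:E)%E.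
  move=> Fr; apply: (@le_trans _ _ (\sum_(0 <= k < n) r%:E)%E).
    by rewrite big_nat [leRHS]big_nat; apply: lee_sum => k /andP[_ /Fr].
  by rewrite sumEFin sumr_const_nat subn0 mulr_natl.
have mt1 k : nonneg_meas (fun x => big_coord a k x * `|psum n (restr (predC (pred1 k)) x)|).
  exact: nonneg_measM.
have mt2 k j : nonneg_meas (fun x =>
    (j != k)%:R * (big_coord a k x * `|x k| * big_coord a j x)).
  apply: nonneg_measM; first exact: nonneg_meas_cst.
  exact: nonneg_measM.
have ms1 : nonneg_meas (fun x => \sum_(0 <= k < n)
    big_coord a k x * `|psum n (restr (predC (pred1 k)) x)|) by exact: nonneg_meas_sum.
have ms2 : nonneg_meas (fun x => \sum_(0 <= k < n) \sum_(0 <= j < n)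
     (j != k)%:R * (big_coord a k x * `|x k| * big_coord a j x)).
  by apply: nonneg_meas_sum => k; exact: nonneg_meas_sum.
have : ((n%:R * u)%:E <= (s + n%:R * (p * (s + e)) + n%:R * (n%:R * (u * p)))%:E)%E.
  have -> : (n%:R * u)%:E = Ex mu (fun x => \sum_(0 <= k < n) big_coord a k x * `|x k|)%R.
    rewrite Ex_sum//; under eq_bigr do rewrite uk.
    by rewrite sumEFin sumr_const_nat subn0 mulr_natl.
  apply: (@le_trans _ _ (Ex mu (fun x => `|psum n x| +
      \sum_(0 <= k < n) big_coord a k x * `|psum n (restr (predC (pred1 k)) x)| +
      \sum_(0 <= k < n) \sum_(0 <= j < n)
         (j != k)%:R * (big_coord a k x * `|x k| * big_coord a j x))%R)).
    apply: le_Ex; first exact: nonneg_meas_sum.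
      by case: (nonneg_measD (nonneg_measD mS ms1) ms2).
    by move=> x; exact: sum_big_coord_le.
  rewrite ExD//; last exact: nonneg_measD.
  rewrite ExD// sE !EFinD; apply: leeD.
    by apply: leeD => //; rewrite Ex_sum//; exact: sum_le.
  rewrite Ex_sum; last by move=> k; exact: nonneg_meas_sum.
  apply: (@sum_le) => k _; rewrite Ex_sum//; apply: (@sum_le) => j _.
  have [->|jk] := eqVneq j k.
    rewrite (@eq_Ex _ _ _ mu _ (fun=> 0)) ?Ex_cst ?lee_fin ?mulr_ge0// => x.
    by rewrite mul0r.
  rewrite (@eq_Ex _ _ _ mu _ (fun x => big_coord a k x * `|x k| * big_coord a j x)) ?t2// => x.
  by rewrite mul1r.
rewrite uE sE eE -!EFinM -EFinD !lee_fin => h.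
have h1 : n%:R * p * (s + e) <= 2^-1 * (s + e) by rewrite ler_wpM2r// addr_ge0.
have h2 : n%:R * p * (n%:R * u) <= 2^-1 * (n%:R * u) by rewrite ler_wpM2r// mulr_ge0.
lra.
Qed.

(** With [N] the integer part of [y / K], the first [N] indicators equal [1] and yield [y] times a
    harmonic sum, at least [y ln (1 + N)]; moreover [1 + y <= 2 K (1 + N)]. *)
Lemma mul_ln_le_nneseries (K y : R) : 1 <= K -> 0 <= y ->
  ((y * ln (1 + y))%:E <= (ln (2 * K) * y)%:E +
   \sum_(0 <= m <oo) ((K * m.+1%:R <= y)%R%:R * y * m.+1%:R^-1)%:E)%E.
Proof.
move=> K1 y0; have K0 : 0 < K by exact: lt_le_trans K1.
pose N := Num.truncn (y / K).
have t0 (m : nat) : 0 <= (K * m.+1%:R <= y)%R%:R * y * m.+1%:R^-1.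
  by rewrite !mulr_ge0// invr_ge0.
apply: (@le_trans _ _ ((ln (2 * K) * y)%:E +
    \sum_(0 <= m < N) ((K * m.+1%:R <= y)%R%:R * y * m.+1%:R^-1)%:E)%E); last first.
  by rewrite leeD2l//; apply: nneseries_lim_ge => m _ _; rewrite lee_fin.
rewrite sumEFin -EFinD lee_fin.
have -> : \sum_(0 <= m < N) (K * m.+1%:R <= y)%R%:R * y * m.+1%:R^-1 =
    y * \sum_(0 <= m < N) m.+1%:R^-1.
  rewrite mulr_sumr; apply: eq_big_nat => m /andP[_ mN].
  rewrite (_ : (_ <= _) = true) ?mul1r//.
  rewrite mulrC -ler_pdivlMr//; apply: (@le_trans _ _ N%:R); first by rewrite ler_nat.
  by rewrite truncn_le divr_ge0// ltW.
apply: (@le_trans _ _ (ln (2 * K) * y + y * ln (1 + N%:R))); last first.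
  by rewrite lerD2l ler_wpM2l// ln_succ_le_harmonic.
have N0 : 0 < 1 + N%:R :> R by rewrite ltr_wpDr.
have K20 : 0 < 2 * K by rewrite mulr_gt0.
rewrite [ln (2 * K) * y]mulrC -mulrDr ler_wpM2l// -lnM ?posrE//.
rewrite ler_ln ?posrE ?mulr_gt0 ?ltr_wpDr//.
have : y < (1 + N%:R) * K by rewrite -ltr_pdivrMr// nat1r truncnS_gt.
have : K <= (1 + N%:R) * K by rewrite ler_peMl ?lerDl// ltW.
lra.
Qed.

End forward.

(** * The logarithmic moment and the zero mean *)

Section necessary_conditions.
Context (R : realType) (B : completeNormedModType R).
Hypothesis sepB : separable_space B.
Variable mu : probability (seqspace B) R.
Hypothesis iid : iid_law mu.
Local Notation T := (seqspace B).
Local Notation EX := (Ex mu (fun x : T => `|x 0%N|)).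
Local Notation EXlog := (Ex mu (fun x : T => `|x 0%N| * ln (1 + `|x 0%N|))).
Local Notation series_mean :=
  (\sum_(0 <= m <oo) ((m.+1%:R ^- 2)%:E * Ex mu (fun x : T => `|psum m.+1 x|)%R))%E.
Hypothesis series_fin : (series_mean < +oo)%E.

Lemma series_mean_term_ge0 m :
  (0 <= (m.+1%:R ^- 2)%:E * Ex mu (fun x : T => `|psum m.+1 x|)%R)%E.
Proof.
apply: mule_ge0; first by rewrite lee_fin invr_ge0 exprn_ge0.
by apply: Ex_ge0; exact: nonneg_meas_psum.
Qed.

Lemma series_mean_ge (N : nat) :
  (\sum_(0 <= m < N) ((m.+1%:R ^- 2)%:E * Ex mu (fun x : T => `|psum m.+1 x|)%R)
   <= series_mean)%E.
Proof. by apply: nneseries_lim_ge => m _ _; exact: series_mean_term_ge0. Qed.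

(** The first term of the series is [EX] itself, and the others are nonnegative. *)
Lemma EX_fin : (EX < +oo)%E.
Proof.
apply: le_lt_trans series_fin; apply: le_trans (series_mean_ge 1).
rewrite big_nat1 expr1n invr1 mul1e.
by rewrite (@eq_Ex _ _ _ mu _ (fun x : T => `|psum 1 x|)) // => x; rewrite /psum big_nat1.
Qed.

Lemma EXlog_fin : (EXlog < +oo)%E.
Proof.
have mN := nonneg_meas_norm_coord B 0.
set e := fine EX.
have e0 : 0 <= e by rewrite fine_ge0// Ex_ge0.
have EXE : EX = e%:E by rewrite fineK// ge0_fin_numE ?Ex_ge0// EX_fin.
(* [2 * e] makes the threshold [K * n] admissible in [Ex_big_coord_le]; adding [1] ensures [1 <= K],
   as the logarithmic comparison requires. *)
pose K := 2 * e + 1.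
have K1 : 1 <= K by rewrite /K; lra.
pose F m (x : T) : R := (K * m.+1%:R <= `|x 0%N|)%R%:R * `|x 0%N| * m.+1%:R^-1.
have mF m : nonneg_meas (F m).
  apply: nonneg_measM; last by apply: nonneg_meas_cst; rewrite invr_ge0.
  by apply: nonneg_measM => //; exact: nonneg_meas_big_coord.
have ExF m : (Ex mu (F m) <= 3%:E * ((m.+1%:R ^- 2)%:E * Ex mu (fun x : T => `|psum m.+1 x|)%R)
    + (m.+1%:R ^- 2 * e)%:E)%E.
  have m0 : 0 < m.+1%:R :> R by [].
  have Km : 0 < K * m.+1%:R by rewrite mulr_gt0// (lt_le_trans _ K1).
  have := @Ex_big_coord_le _ _ sepB _ iid EX_fin m.+1 _ Km.
  have -> : 2 * m.+1%:R * fine EX <= K * m.+1%:R.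
    by rewrite -/e -mulrA [_ * e]mulrC mulrA ler_wpM2r// /K lerDl.
  move=> /(_ isT); set U := Ex mu _ => h.
  have -> : Ex mu (F m) = ((m.+1%:R ^- 2)%:E * (m.+1%:R%:E * U))%E.
    rewrite muleA -EFinM -ExZ; last 2 first.
    - by rewrite mulr_ge0// invr_ge0 exprn_ge0.
    - by apply: nonneg_measM => //; exact: nonneg_meas_big_coord.
    apply: eq_Ex => x; rewrite /F /big_coord mulrC; congr (_ * _).
    by rewrite expr2 invfM -mulrA mulVf ?mulr1// gt_eqF.
  apply: (@le_trans _ _ ((m.+1%:R ^- 2)%:E *
     (3%:E * Ex mu (fun x : T => `|psum m.+1 x|)%R + EX))%E).
    by apply: lee_wpmul2l => //; rewrite lee_fin invr_ge0 exprn_ge0.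
  rewrite ge0_muleDr; last 2 first.
  - by apply: mule_ge0 => //; apply: Ex_ge0; exact: nonneg_meas_psum.
  - exact: Ex_ge0.
  by rewrite muleCA EXE -EFinM.
have sumF : (\sum_(0 <= m <oo) Ex mu (F m) < +oo)%E.
  apply: (@le_lt_trans _ _ (\sum_(0 <= m <oo)
     (3%:E * ((m.+1%:R ^- 2)%:E * Ex mu (fun x : T => `|psum m.+1 x|)%R)
    + (m.+1%:R ^- 2 * e)%:E))%E).
    by apply: lee_nneseries => m *; [exact: Ex_ge0|exact: ExF].
  rewrite nneseriesD; last 2 first.
  - by move=> m _ _; rewrite mule_ge0// series_mean_term_ge0.
  - by move=> m _ _; rewrite lee_fin mulr_ge0// invr_ge0 exprn_ge0.
  rewrite nneseriesZl; last by move=> m _; exact: series_mean_term_ge0.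
  apply: lte_add_pinfty; first by rewrite lte_mul_pinfty.
  (* The remainders [e / n^2] sum to at most [2 * e]. *)
  apply: (@le_lt_trans _ _ (2 * e)%:E); last exact: ltry.
  apply: lime_le.
    by apply: is_cvg_nneseries => m _ _; rewrite lee_fin mulr_ge0// invr_ge0 exprn_ge0.
  apply: nearW => N; rewrite sumEFin lee_fin -mulr_suml ler_wpM2r//.
  by have := sum_inv_sqr_le R 0 N; rewrite divr1.
have mlnX : measurable_fun setT (fun x : T => ln (2 * K) * `|x 0%N|).
  by apply: measurable_funM => //; case: mN.
have msF : measurable_fun setT (fun x : T => (\sum_(0 <= m <oo) (F m x)%:E)%E).
  apply: (ge0_emeasurable_sum (P := xpredT)) => [m x _ _|m _].
    by rewrite lee_fin; case: (mF m).
  by apply/measurable_EFinP; case: (mF m).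
have ln0 : 0 <= ln (2 * K) by rewrite ln_ge0//; lra.
apply: (@le_lt_trans _ _ (\int[mu]_x ((ln (2 * K) * `|x 0%N|)%:E +
   \sum_(0 <= m <oo) (F m x)%:E))%E).
  apply: ge0_le_integral => //.
  - by move=> x _; rewrite lee_fin; case: (nonneg_meas_log B).
  - by apply/measurable_EFinP; case: (nonneg_meas_log B).
  - by apply: emeasurable_funD => //; exact/measurable_EFinP.
  - by move=> x _; exact: mul_ln_le_nneseries.
rewrite ge0_integralD//; last 3 first.
- by move=> x _; rewrite lee_fin mulr_ge0.
- exact/measurable_EFinP.
- by move=> x _; apply: nneseries_ge0 => m _ _; rewrite lee_fin; case: (mF m).
apply: lte_add_pinfty.
  by rewrite -/(Ex mu (fun x : T => ln (2 * K) * `|x 0%N|)) ExZ// EXE -EFinM ltry.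
rewrite integral_nneseries//.
- by move=> m; apply/measurable_EFinP; case: (mF m).
- by move=> m x _; rewrite lee_fin; case: (mF m).
Qed.

(** * Continuous linear functionals *)

Section functional.
Variable phi : B -> R.
Hypothesis phi_linear : forall (a : R) (x y : B), phi (a *: x + y) = a * phi x + phi y.
Hypothesis phi_continuous : continuous phi.

Lemma functionalD x y : phi (x + y) = phi x + phi y.
Proof. by rewrite -[x in LHS]scale1r phi_linear mul1r. Qed.

Lemma functional0 : phi 0 = 0.
Proof. by apply: (addrI (phi 0)); rewrite -functionalD !addr0. Qed.

Lemma functional_sum (n : nat) (x : nat -> B) :
  phi (\sum_(0 <= i < n) x i) = \sum_(0 <= i < n) phi (x i).
Proof.
elim: n => [|n IH]; first by rewrite !big_geq// functional0.
by rewrite !big_nat_recr//= functionalD IH.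
Qed.

Lemma functional_bounded : exists2 C : R, 0 < C & forall x, `|phi x| <= C * `|x|.
Proof.
have /cvgrPdist_lt/(_ 1 ltr01)/nbhs_ballP[r r0 hr] := @phi_continuous 0.
(* [phi] stays below [1] in absolute value on the ball of radius [r]; a nonzero vector is scaled to
   norm [r / 2] to lie inside it. *)
exists (2 / r); first by rewrite divr_gt0.
move=> x; have [->|x0] := eqVneq x 0; first by rewrite functional0 !normr0 mulr0.
have nx0 : 0 < `|x| by rewrite normr_gt0.
have a0 : 0 < r / 2 / `|x| by rewrite !divr_gt0.
have nax : `|(r / 2 / `|x|) *: x| = r / 2.
  by rewrite normrZ gtr0_norm// divfK// gt_eqF.
have pax : `|phi ((r / 2 / `|x|) *: x)| = r / 2 / `|x| * `|phi x|.
  by rewrite -[_ *: x]addr0 phi_linear functional0 addr0 normrM gtr0_norm.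
have := hr ((r / 2 / `|x|) *: x).
rewrite -ball_normE /= sub0r normrN nax functional0 sub0r normrN pax.
rewrite gtr_pMr// invf_lt1 ?ltr1n// => /(_ isT).
rewrite mulrAC ltr_pdivrMr// mul1r => h.
rewrite -(invf_div r 2) -ler_pdivrMl ?invr_gt0 ?divr_gt0//.
by rewrite invrK ltW.
Qed.

Lemma measurable_functional_coord i : measurable_fun setT (fun x : T => phi (x i)).
Proof. exact: borel_rv_continuous (@borel_rv_coord R B i) phi_continuous. Qed.

Lemma functional_coord_integrable i :
  mu.-integrable setT (fun x : T => (phi (x i))%:E).
Proof.
have [C C0 hC] := functional_bounded.
apply/integrableP; split.
  by apply/measurable_EFinP; exact: measurable_functional_coord.
under eq_integral do rewrite abse_EFin.
apply: (@le_lt_trans _ _ (Ex mu (fun x : T => C * `|x i|))).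
  apply: le_Ex => //.
    by split => //; apply: measurableT_comp => //; exact: measurable_functional_coord.
  by apply: measurable_funM => //; case: (nonneg_meas_norm_coord B i).
rewrite ExZ ?(ltW C0)//; last exact: nonneg_meas_norm_coord.
rewrite (Ex_norm_coord iid (f := @Num.norm R B) i (nonneg_meas_norm_coord B 0)).
by rewrite lte_mul_pinfty ?lee_fin ?(ltW C0)// EX_fin.
Qed.

Lemma integral_functional_coord i :
  (\int[mu]_x (phi (x i))%:E = \int[mu]_x (phi (x 0%N))%:E)%E.
Proof.
apply: (integral_same_law (P1 := mu) (P2 := mu) (X := fun x : T => x i)
   (Y := fun x : T => x 0%N) (f := fun b => (phi b)%:E)).
- exact: borel_rv_coord.
- exact: borel_rv_coord.
- move=> A bA; exact: (shiftseq_law iid i (@borel_rv_coord R B 0 A bA)).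
- apply/measurable_EFinP.
  by apply: (@borel_rv_continuous _ _ _ (g_sigma_algebraType (@open B)) id).
Qed.

(** If [t] is the mean, linearity gives [n |t| <= C E|S_n|]. Dividing by [n^2] and summing bounds
    [|t| ln (1 + N)] uniformly in [N], which forces [t = 0]. *)
Lemma functional_mean_zero : (\int[mu]_x (phi (x 0%N))%:E = 0)%E.
Proof.
have [C C0 hC] := functional_bounded.
have int0 := functional_coord_integrable 0.
set t := (\int[mu]_x _)%E; have tfin : t \is a fin_num by exact: integrable_fin_num.
have sumE n : (\int[mu]_x (phi (psum n x))%:E = (n%:R * fine t)%:E)%E.
  under eq_integral do rewrite functional_sum -sumEFin.
  rewrite integral_sum//; last exact: functional_coord_integrable.
  under eq_bigr do rewrite integral_functional_coord -/t -(fineK tfin).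
  by rewrite sumEFin sumr_const_nat subn0 mulr_natl.
have lower n : ((n%:R * `|fine t|)%:E <= C%:E * Ex mu (fun x : T => `|psum n x|)%R)%E.
  have -> : (n%:R * `|fine t|)%:E = `|\int[mu]_x (phi (psum n x))%:E|%E.
    by rewrite sumE abse_EFin normrM normr_nat.
  have mp : measurable_fun setT (fun x : T => phi (psum n x)).
    exact: (borel_rv_continuous (borel_psum sepB n) phi_continuous).
  apply: (@le_trans _ _ (Ex mu (fun x : T => `|phi (psum n x)|)%R)).
    by apply: le_trans (le_abse_integral _ _ _) _ => //; exact/measurable_EFinP.
  rewrite -ExZ ?(ltW C0)//; last exact: nonneg_meas_psum.
  apply: le_Ex => //.
    by split => //; exact: measurableT_comp.
  by apply: measurable_funM => //; case: (nonneg_meas_psum sepB n).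
set H := fine series_mean.
have HE : series_mean = H%:E.
  rewrite fineK// ge0_fin_numE// nneseries_ge0// => m _ _; exact: series_mean_term_ge0.
have ln_le (N : nat) : `|fine t| * ln (1 + N%:R) <= C * H.
  apply: (@le_trans _ _ (`|fine t| * \sum_(0 <= i < N) i.+1%:R^-1)).
    by rewrite ler_wpM2l// ln_succ_le_harmonic.
  rewrite -lee_fin [leRHS]EFinM -HE.
  apply: (@le_trans _ _ (C%:E * (\sum_(0 <= m < N) ((m.+1%:R ^- 2)%:E *
     Ex mu (fun x : T => `|psum m.+1 x|)%R)))%E); last first.
    by apply: lee_wpmul2l; [rewrite lee_fin ltW|exact: series_mean_ge].
  rewrite ge0_sume_distrr; last by move=> m _; exact: series_mean_term_ge0.
  rewrite mulr_sumr -sumEFin; apply: lee_sum => m _.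
  rewrite muleCA.
  apply: (@le_trans _ _ ((m.+1%:R ^- 2)%:E * (m.+1%:R * `|fine t|)%:E)%E); last first.
    by apply: lee_wpmul2l => //; rewrite lee_fin invr_ge0 exprn_ge0.
  have m0 : m.+1%:R != 0 :> R by rewrite pnatr_eq0.
  by rewrite -EFinM lee_fin mulrA expr2 invfM -[_^-1 * _ * _]mulrA mulVf// mulr1 mulrC.
have [t0|t_neq0] := eqVneq (fine t) 0; first by rewrite -(fineK tfin) t0.
have tgt0 : 0 < `|fine t| by rewrite normr_gt0.
(* [M] is where [|t| ln M] reaches the bound [C * H]; an integer above it contradicts [ln_le]. *)
exfalso; set M := expR (C * H / `|fine t|).
have := ln_le (Num.truncn M).+1.
rewrite mulrC -ler_pdivlMr// -ler_expR lnK ?posrE ?addr_gt0// -/M.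
by apply/negP; rewrite -ltNge (lt_le_trans (truncnS_gt _))// lerDr.
Qed.

End functional.
End necessary_conditions.

(** * The equivalence on the original probability space *)

Unset Implicit Arguments.

Theorem theorem2p2 (R : realType) (B : completeNormedModType R)
    (d : measure_display) (Omega : measurableType d) (P : probability Omega R)
    (X : Omega -> B) (Xn : nat -> Omega -> B) :
  separable_space B ->
  iid_copies P X Xn ->
  let S := fun (n : nat) (w : Omega) => \sum_(k < n) Xn k w in
  ((\sum_(1 <= n <oo) ((n%:R ^-2)%:E * \int[P]_w (`|S n w|)%:E) < +oo)%E
   <->
   [/\ {ae P, forall w, (\sum_(1 <= n <oo) (`|S n w| / n%:R ^+ 2)%:E < +oo)%E},
       pettis_expectation P X 0 &
       (\int[P]_w (`|X w| * ln (1 + `|X w|))%:E < +oo)%E]).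
Proof.
move=> sepB XXn S.
pose mu : probability (seqspace B) R := distribution P (path_mfun XXn).
have iid : iid_law mu := iid_law_path XXn.
have SE n w : S n w = psum n (sample_path Xn w) by rewrite /psum big_mkord.
have intS n : (\int[P]_w (`|S n w|)%:E)%E = Ex mu (fun x => `|psum n x|).
  rewrite /Ex integral_path.
  - by under eq_integral do rewrite SE.
  - by apply/measurable_EFinP; case: (nonneg_meas_psum sepB n).
  - by move=> x; rewrite lee_fin.
have term_ge0 m x : (0 <= (`|psum m.+1 (x : seqspace B)| / m.+1%:R ^+ 2)%:E)%E.
  by rewrite lee_fin divr_ge0// exprn_ge0.
have seriesS : (\sum_(1 <= n <oo) ((n%:R ^-2)%:E * \int[P]_w (`|S n w|)%:E))%E =
    (\sum_(0 <= m <oo) ((m.+1%:R ^- 2)%:E * Ex mu (fun x => `|psum m.+1 x|)%R))%E.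
  rewrite -nneseries_addn.
    by apply: eq_eseriesr => m _; rewrite addn1 intS.
  move=> n; apply: mule_ge0; first by rewrite lee_fin invr_ge0 exprn_ge0.
  by apply: integral_ge0 => w _; rewrite lee_fin.
have seriesw w : (\sum_(1 <= n <oo) (`|S n w| / n%:R ^+ 2)%:E)%E =
    (\sum_(0 <= m <oo) (`|psum m.+1 (sample_path Xn w)| / m.+1%:R ^+ 2)%:E)%E.
  rewrite -nneseries_addn; first by apply: eq_eseriesr => m _; rewrite addn1 SE.
  by move=> n; rewrite lee_fin divr_ge0// exprn_ge0.
have bid : borel_rv (fun b : g_sigma_algebraType (@open B) => b : B) by [].
have mnorm : measurable_fun setT (fun b : g_sigma_algebraType (@open B) => `|b : B|).
  exact: borel_rv_norm bid.
have intlog : (\int[P]_w (`|X w| * ln (1 + `|X w|))%:E)%E =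
    Ex mu (fun x => `|x 0%N| * ln (1 + `|x 0%N|)).
  apply: (integral_copy XXn (f := fun b : B => (`|b| * ln (1 + `|b|))%:E)).
  apply/measurable_EFinP; apply: measurable_funM => //.
  apply: measurableT_comp (@measurable_ln R) _.
  by apply: measurable_funD => //; exact: measurable_cst.
have mV : measurable_fun setT (fun x : seqspace B =>
    (\sum_(0 <= m <oo) (`|psum m.+1 x| / m.+1%:R ^+ 2)%:E)%E).
  apply: (ge0_emeasurable_sum (P := xpredT)) => [m x _ _|m _]; first exact: term_ge0.
  by apply/measurable_EFinP; case: (nonneg_meas_psum_sqr sepB m).
pose V (x : seqspace B) := (\sum_(0 <= m <oo) (`|psum m.+1 x| / m.+1%:R ^+ 2)%:E)%E.
pose N : set (seqspace B) := [set x | ~ (V x < +oo)%E].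
(* Almost sure convergence is compared through the divergence events on the two spaces: both are
   measurable, and one is the preimage of the other. *)
pose NS : set Omega := [set w | ~ (\sum_(1 <= n <oo) (`|S n w| / n%:R ^+ 2)%:E < +oo)%E].
have mN : measurable N.
  rewrite (_ : N = ~` (setT `&` [set x | (V x < +oo)%E])); last by rewrite setTI.
  by apply: measurableC; exact: emeasurable_fun_infty_o.
have NSE : NS = path_mfun XXn @^-1` N.
  by apply/seteqP; split => w /=; rewrite /NS /N /= seriesw.
have mNS : measurable NS.
  by rewrite NSE -[X in measurable X]setTI; exact: measurable_funP.
have muN : mu N = P NS by rewrite NSE.
have exw m : Ex mu (fun x => `|psum m.+1 x| / m.+1%:R ^+ 2) =
    ((m.+1%:R ^- 2)%:E * Ex mu (fun x => `|psum m.+1 x|)%R)%E.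
  rewrite (@eq_Ex _ _ _ mu _ (fun x => m.+1%:R ^- 2 * `|psum m.+1 x|)); last first.
    by move=> x; rewrite mulrC.
  by rewrite ExZ ?invr_ge0 ?exprn_ge0//; exact: nonneg_meas_psum.
have [mX _ _ _] := XXn.
rewrite seriesS; split.
  move=> series_fin; split.
  (* By Tonelli's theorem the mean of [V] is the series of means, so [V] is integrable and hence
     finite almost everywhere. *)
  - have intV : mu.-integrable setT V.
      apply/integrableP; split => //.
      under eq_integral => x _ do rewrite gee0_abs ?nneseries_ge0//.
      rewrite integral_nneseries//; last first.
        by move=> m; apply/measurable_EFinP; case: (nonneg_meas_psum_sqr sepB m).
      by under eq_eseriesr => m _ do rewrite -/(Ex mu (fun x => `|psum m.+1 x| / m.+1%:R ^+ 2)) exw.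
    exists NS; split => //.
    rewrite -muN; apply: measure_negligible => //.
    apply: negligibleS (integrable_ae measurableT intV) => x Nx /= /(_ I) Vx.
    by apply: Nx; rewrite ltey_eq Vx.
  - move=> phi philin phicont.
    have mphi : measurable_fun setT (fun b : g_sigma_algebraType (@open B) => phi b).
      exact: borel_rv_continuous bid phicont.
    split.
      have /integrableP[_ intphi] :=
        functional_coord_integrable sepB iid series_fin philin phicont 0.
      apply/integrableP; split.
        apply/measurable_EFinP; exact: borel_rv_continuous mX phicont.
      rewrite (integral_copy XXn (f := fun b => `|(phi b)%:E|%E))//.
      by apply: measurableT_comp => //; exact/measurable_EFinP.
    rewrite (functional0 philin).
    rewrite (integral_copy XXn (f := fun b => (phi b)%:E)).
      exact: functional_mean_zero series_fin _ philin phicont.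
    exact/measurable_EFinP.
  - by rewrite intlog; exact: EXlog_fin series_fin.
move=> [ae_fin _]; rewrite intlog => log_fin.
have ae_mu : {ae mu, forall x : seqspace B,
    (\sum_(0 <= m <oo) (`|psum m.+1 x| / m.+1%:R ^+ 2)%:E < +oo)%E}.
  exists N; split => //; rewrite muN; apply: measure_negligible => //.
have [C hC] := Ex_wsum_bounded sepB iid ae_mu log_fin.
apply: (@le_lt_trans _ _ C%:E); last exact: ltry.
apply: lime_le.
  by apply: is_cvg_nneseries => m _ _; exact: series_mean_term_ge0.
(* The means of [wsum] are the partial sums of the series of means, so their common bound bounds the
   series. *)
apply: nearW => n; apply: le_trans (hC n).
rewrite Ex_sum; last by move=> i; exact: nonneg_meas_psum_sqr.
apply: lee_sum => m _.
by rewrite exw.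
Qed.
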